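(* Let $(\bar M^n,\bar g)$ be a Riemannian manifold, $l>0$, $\Phi\in\mathbb R$, and let the warped product metrics $g_t=dx^2+\varphi^2(t,x)\,\bar g$, $t\ge 0$, on $M=[0,l]\times\bar M$ solve the normalized Partial Ricci Flow $\partial_t g=-2\,r(g)+2\,\Phi\,\hat g$ with $N=\partial_x$; equivalently, $\varphi$ is the classical solution of $$\partial_t\varphi=\varphi_{,xx}+\Phi\varphi,\quad \varphi(0,x)=\varphi_0(x),\quad \varphi(t,0)=\mu_0(t),\quad \varphi(t,l)=\mu_1(t),$$ where for $j=0,1$ the functions $\mu_j\ge0$ are continuously differentiable on $[0,\infty)$ and the limits $\lim_{t\to\infty}\mu_j(t)=\tilde\mu_j$, $\lim_{t\to\infty}\mu_j'(t)=0$ exist. If $\Phi>(\pi/l)^2$, then the metrics diverge as $t\to\infty$. Otherwise, in the cases (i) and (ii) below, the metrics converge uniformly for $x\in[0,l]$ to the limit metric $g_\infty$ described there, which satisfies $r(g_\infty)=\Phi\,\hat g_\infty$ (where its warping function is nonzero), so that the mixed sectional curvature of $g_\infty$ is constant. (i) If $\Phi<(\pi/l)^2$, then $g_\infty=dx^2+\tilde\varphi^2(x)\,\bar g$, where $$\tilde\varphi(x)=\begin{cases}\dfrac{\tilde\mu_1\sin(\sqrt{\Phi}\,x)+\tilde\mu_0\sin(\sqrt{\Phi}\,(l-x))}{\sin(\sqrt{\Phi}\,l)} & \text{if } 0<\Phi<(\pi/l)^2,\\[2mm] \tilde\mu_0+(\tilde\mu_1-\tilde\mu_0)(x/l) & \text{if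 }\Phi=0,\\[1mm] \dfrac{\tilde\mu_1\sinh(\sqrt{-\Phi}\,x)+\tilde\mu_0\sinh(\sqrt{-\Phi}\,(l-x))}{\sinh(\sqrt{-\Phi}\,l)} & \text{if }\Phi<0.\end{cases}$$ (ii) If $\Phi=(\pi/l)^2$ and the additional assumptions $$\tilde\mu_j=0,\qquad \int_0^\infty\big(|\delta_j(\tau)|+|\delta_j'(\tau)|\big)\,d\tau<\infty\qquad(j=0,1)$$ hold, where $\delta_j(t)=\mu_j(t)-\tilde\mu_j$, then $g_\infty=dx^2+\varphi_\infty^2(x)\,\bar g$ with $$\varphi_\infty(x)=\Big(v_1^0+\int_0^\infty f_1(\tau)\,d\tau\Big)\sin(\pi x/l).$$
   Context: For a Riemannian metric $g$ with unit vector field $N$: $R(X,Y)=\nabla_Y\nabla_X-\nabla_X\nabla_Y+\nabla_{[X,Y]}$, $R(X,Y,Z,V)=g(R(X,Y)Z,V)$, $r(X,Y)=R(X,N,Y,N)$; $\hat g(X,Y)=g(X^\perp,Y^\perp)$ where $^\perp$ is the component orthogonal to $N$; mixed sectional curvatures are sectional curvatures of planes containing $N$. For a warped product metric $dx^2+\varphi^2(x)\bar g$ with $\varphi>0$ in the interior $0<x<l$ and $N=\partial_x$, one has $r=-(\varphi_{,xx}/\varphi)\,\hat g$ where $\varphi\ne0$. Convergence (uniform in $x\in[0,l]$) or divergence of the metrics $g_t$ means convergence (uniform in $x\in[0,l]$) or divergence of the warping functions $\varphi(t,\cdot)$ as $t\to\infty$. Notation for (ii): $U(t,x)=\delta_0(t)\frac{l-x}{l}+\delta_1(t)\frac{x}{l}$;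 $v_0(x)=\varphi_0(x)-U(0,x)$; $f(t,x)=\Phi\,U-\partial_t U$; and the first Fourier sine coefficients are $f_1(t)=\frac2l\int_0^l f(t,s)\sin(\pi s/l)\,ds$ and $v_1^0=\frac2l\int_0^l v_0(s)\sin(\pi s/l)\,ds$. *)

(* Defs.v *)
From HB Require Import structures.
From mathcomp Require Import all_boot all_order all_algebra.
From mathcomp Require Import all_classical all_reals all_analysis.

Set Implicit Arguments.
Unset Strict Implicit.
Unset Printing Implicit Defensive.

Import Order.TTheory GRing.Theory Num.Theory numFieldNormedType.Exports.

Local Open Scope classical_set_scope.
Local Open Scope ring_scope.

Section Manifolds.
Context {R : realType}.

Definition partial m (i : 'I_m) (f : 'rV[R]_m -> R) : 'rV[R]_m -> R :=
  fun x => 'D_(delta_mx 0 i) f x.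

Definition iter_partial m (s : seq 'I_m) (f : 'rV[R]_m -> R) : 'rV[R]_m -> R :=
  foldr (@partial m) f s.

(* Only used on open sets A. *)
Definition smooth_on m (A : set 'rV[R]_m) (f : 'rV[R]_m -> R) : Prop :=
  forall (s : seq 'I_m) (x : 'rV[R]_m), A x ->
    {for x, continuous (iter_partial s f)} /\
    forall i, derivable (iter_partial s f) x (delta_mx 0 i).

End Manifolds.

(* [chart_map c] is meaningful on [dom c] only, and [param c], its inverse, on the
   image of [dom c] only. *)
Record smooth_manifold (R : realType) (n : nat) := SmoothManifold {
  carrier :> topologicalType ;
  chart : Type ;
  dom : chart -> set carrier ;
  chart_map : chart -> carrier -> 'rV[R]_n ;
  param : chart -> 'rV[R]_n -> carrier ;
  manifold_hausdorff : hausdorff_space carrier ;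
  manifold_second_countable : @second_countable carrier ;
  manifold_nonempty : [set: carrier] !=set0 ;
  dom_cover : forall q, exists c, dom c q ;
  dom_open : forall c, open (dom c) ;
  chart_map_open : forall c, open (chart_map c @` dom c) ;
  chart_mapK : forall c q, dom c q -> param c (chart_map c q) = q ;
  chart_map_continuous : forall c, {within dom c, continuous (chart_map c)} ;
  param_continuous : forall c,
    {within chart_map c @` dom c, continuous (param c)} ;
  transition_smooth : forall c d (j : 'I_n),
    smooth_on (chart_map c @` (dom c `&` dom d))
              (fun y => chart_map d (param c y) 0 j) }.

(* A Riemannian metric is given by its coefficient matrices in all charts.
   Tangent vectors are row vectors v of components and a matrix G stands for
   the bilinear form (v, w) |-> v *m G *m w^T. *)
Record riemannian_metric (R : realType) (n : nat) (M : smooth_manifold R n) :=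
  RiemannianMetric {
  coef :> forall c : chart M, 'rV[R]_n -> 'M[R]_n ;
  coef_smooth : forall c i j,
    smooth_on (chart_map c @` dom c) (fun y => coef c y i j) ;
  coef_sym : forall c q, dom c q ->
    (coef c (chart_map c q))^T = coef c (chart_map c q) ;
  coef_pos : forall c q (v : 'rV[R]_n), dom c q -> v != 0 ->
    0 < (v *m coef c (chart_map c q) *m v^T) 0 0 ;
  coef_change : forall c d q, dom c q -> dom d q ->
    let J := jacobian (chart_map d \o param c) (chart_map c q) in
    coef c (chart_map c q) = J *m coef d (chart_map d q) *m J^T }.

(* Levi-Civita connection and curvature, in coordinates, of a metric with
   coefficient matrix g; vector fields are maps 'rV_m -> 'rV_m. *)
Section Curvature.
Context {R : realType} {m : nat}.
Implicit Types (g : 'rV[R]_m -> 'M[R]_m) (X Y Z V : 'rV[R]_m -> 'rV[R]_m).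
Implicit Types (p a b : 'rV[R]_m).

Definition inner g p a b : R := (a *m g p *m b^T) 0 0.

Definition christoffel g (k i j : 'I_m) p : R :=
  2^-1 * \sum_(h < m) invmx (g p) k h *
    (partial i (fun q => g q j h) p + partial j (fun q => g q i h) p
     - partial h (fun q => g q i j) p).

Definition covariant g X Y : 'rV[R]_m -> 'rV[R]_m :=
  fun p => \row_k ('D_(X p) (fun q => Y q 0 k) p +
    \sum_(i < m) \sum_(j < m) christoffel g k i j p * X p 0 i * Y p 0 j).

Definition lie_bracket X Y : 'rV[R]_m -> 'rV[R]_m :=
  fun p => \row_k ('D_(X p) (fun q => Y q 0 k) p - 'D_(Y p) (fun q => X q 0 k) p).

(* The sign convention is R(X,Y) = nabla_Y nabla_X - nabla_X nabla_Y
   + nabla_[X,Y], for which R(X,Y,X,Y) > 0 on round spheres. *)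
Definition curvature g X Y Z : 'rV[R]_m -> 'rV[R]_m :=
  fun p => covariant g Y (covariant g X Z) p
         - covariant g X (covariant g Y Z) p
         + covariant g (lie_bracket X Y) Z p.

Definition curvature4 g X Y Z V p : R := inner g p (curvature g X Y Z p) (V p).

(* The tensors below are evaluated at tangent vectors, which are extended to
   vector fields with constant components; tensoriality makes the choice of the
   extension irrelevant. *)
Definition partial_ricci g (N : 'rV[R]_m) p a b : R :=
  curvature4 g (cst a) (cst N) (cst b) (cst N) p.

Definition perp g (N : 'rV[R]_m) p a : 'rV[R]_m := a - inner g p a N *: N.

Definition metric_perp g (N : 'rV[R]_m) p a b : R :=
  inner g p (perp g N p a) (perp g N p b).

(* Sectional curvature of the plane spanned by a and b. *)
Definition sectional g p a b : R :=
  curvature4 g (cst a) (cst b) (cst a) (cst b) p /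
  (inner g p a a * inner g p b b - inner g p a b ^+ 2).

End Curvature.

Section WarpedProduct.
Context {R : realType} {n : nat} {M : smooth_manifold R n}.
Variable h : riemannian_metric M.

(* A chart c of M gives the coordinates (x, y) = row_mx x%:M y of R x M;
   [warped h w c] is the matrix of dx^2 + w(x)^2 h in these coordinates. *)
Definition warped (w : R -> R) (c : chart M) (p : 'rV[R]_(1 + n)) :
    'M[R]_(1 + n) :=
  block_mx 1%:M 0 0 (w (lsubmx p 0 0) ^+ 2 *: h c (rsubmx p)).

Definition warped_point (c : chart M) (x : R) (q : M) : 'rV[R]_(1 + n) :=
  row_mx x%:M (chart_map c q).

Definition dx_field : 'rV[R]_(1 + n) := row_mx 1%:M 0.

(* d/dt g_t = - 2 r(g_t) + 2 Phi \hat g_t on ]0, l[ x M, for g_t the warped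
   product with warping function phi t, and N = d/dx. *)
Definition normalized_partial_ricci_flow (l Phi : R) (phi : R -> R -> R) : Prop :=
  forall (t x : R) (c : chart M) (q : M) (a b : 'rV[R]_(1 + n)),
    0 < t -> 0 < x < l -> dom c q ->
    let p := warped_point c x q in
    derive1 (fun s => inner (warped (phi s) c) p a b) t =
    - 2 * partial_ricci (warped (phi t) c) dx_field p a b
    + 2 * Phi * metric_perp (warped (phi t) c) dx_field p a b.

(* r = Phi \hat g on [0, l] x M where w is nonzero. The function w is given by
   a formula on all of R, so that at x = 0 and x = l its derivatives are those
   from inside. *)
Definition partial_ricci_proportional (l Phi : R) (w : R -> R) : Prop :=
  forall (x : R) (c : chart M) (q : M) (a b : 'rV[R]_(1 + n)),
    0 <= x <= l -> w x != 0 -> dom c q ->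
    let p := warped_point c x q in
    partial_ricci (warped w c) dx_field p a b =
    Phi * metric_perp (warped w c) dx_field p a b.

Definition constant_mixed_curvature (l K : R) (w : R -> R) : Prop :=
  forall (x : R) (c : chart M) (q : M) (a : 'rV[R]_(1 + n)),
    0 <= x <= l -> w x != 0 -> dom c q -> (forall k : R, a <> k *: dx_field) ->
    sectional (warped w c) (warped_point c x q) a dx_field = K.

End WarpedProduct.

Section Problem.
Context {R : realType}.

(* Derivative of f on [0, +oo[: one-sided at 0, two-sided elsewhere. *)
Definition half_quotient (f : R -> R) (t s : R) : R := (f s - f t) / (s - t).

Definition half_derive (f : R -> R) (t : R) : R :=
  lim (half_quotient f t s @[s --> within `[0, +oo[%classic t^']).

Definition C1_half_line (f : R -> R) : Prop :=
  (forall t, 0 <= t ->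
     cvg (half_quotient f t s @[s --> within `[0, +oo[%classic t^'])) /\
  {within `[0, +oo[%classic, continuous (half_derive f)}.

(* phi is continuous on [0, +oo[ x [0, l] and of class C^{1,2} on
   ]0, +oo[ x ]0, l[. *)
Definition classical_regularity (l : R) (phi : R -> R -> R) : Prop :=
  {within [set z : R * R | 0 <= z.1 /\ 0 <= z.2 <= l],
     continuous (fun z : R * R => phi z.1 z.2)} /\
  forall t x, 0 < t -> 0 < x < l ->
    [/\ derivable (phi^~ x) t 1, derivable (phi t) x 1 &
        derivable (derive1 (phi t)) x 1] /\
    [/\ {for (t, x), continuous (fun z : R * R => derive1 (phi^~ z.2) z.1)},
        {for (t, x), continuous (fun z : R * R => derive1 (phi z.1) z.2)} &
        {for (t, x), continuous (fun z : R * R => derive1n 2 (phi z.1) z.2)}].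

Definition heat_equation (l Phi : R) (phi : R -> R -> R) : Prop :=
  forall t x, 0 < t -> 0 < x < l ->
    derive1 (phi^~ x) t = derive1n 2 (phi t) x + Phi * phi t x.

(* Convergence of the metrics g_t, as t -> +oo, to the one with warping
   function w. *)
Definition metrics_converge (l : R) (phi : R -> R -> R) (w : R -> R) : Prop :=
  {uniform `[0, l]%classic, phi @ +oo --> w}.

Definition metrics_diverge (l : R) (phi : R -> R -> R) : Prop :=
  ~ exists w, metrics_converge l phi w.

Definition sinh (x : R) : R := (expR x - expR (- x)) / 2.

(* Meaningful for Phi < (pi / l)^2. *)
Definition phi_tilde (l Phi m0 m1 x : R) : R :=
  if 0 < Phi then
    (m1 * sin (Num.sqrt Phi * x) + m0 * sin (Num.sqrt Phi * (l - x)))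
    / sin (Num.sqrt Phi * l)
  else if Phi == 0 then m0 + (m1 - m0) * (x / l)
  else
    (m1 * sinh (Num.sqrt (- Phi) * x) + m0 * sinh (Num.sqrt (- Phi) * (l - x)))
    / sinh (Num.sqrt (- Phi) * l).

Section Fourier.
Variables (l Phi : R) (delta0 delta1 phi0 : R -> R).
Local Notation leb := (@lebesgue_measure R).

Definition Ufun (t x : R) : R := delta0 t * ((l - x) / l) + delta1 t * (x / l).

Definition ffun_source (t x : R) : R :=
  Phi * Ufun t x - half_derive (fun s => Ufun s x) t.

Definition v0fun (x : R) : R := phi0 x - Ufun 0 x.

Definition f1coef (t : R) : R :=
  2 / l * (\int[leb]_(s in `[0, l]) (ffun_source t s * sin (pi * s / l)))%R.

Definition v1coef : R :=
  2 / l * (\int[leb]_(s in `[0, l]) (v0fun s * sin (pi * s / l)))%R.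

Definition phi_infty (x : R) : R :=
  (v1coef + (\int[leb]_(t in `[0, +oo[) f1coef t)%R) * sin (pi * x / l).

End Fourier.

Definition integrable_with_derivative (delta : R -> R) : Prop :=
  (\int[@lebesgue_measure R]_(t in `[(0 : R)%R, +oo[)
     (`|delta t| + `|half_derive delta t|)%:E < +oo)%E.

End Problem.

(* Main.v *)
Require Import Defs.
From HB Require Import structures.
From mathcomp Require Import all_boot all_order all_algebra.
From mathcomp Require Import all_classical all_reals all_analysis.
From mathcomp Require Import measurable_realfun ring lra.
Import Order.TTheory GRing.Theory Num.Theory numFieldNormedType.Exports.
Local Open Scope classical_set_scope.
Local Open Scope ring_scope.

(* The curvature computation r = - w w'' gbar for dx^2 + w(x)^2 gbar turns the
   flow into the heat equation with reaction term, to which the weak maximum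
   principle applies; it needs derivatives in the open strip only.
   - Phi > (pi/l)^2: on a slightly smaller interval the first eigenvalue is still
     below Phi, and a multiple of exp(lam t) times the eigenfunction is a
     subsolution below phi.
   - Phi < (pi/l)^2: a cosine of frequency between sqrt(Phi) and pi/l is positive
     on [0, l] and gives decaying supersolutions for phi minus the limit.
   - Phi = (pi/l)^2: a late profile is approximated uniformly by sin * Q(cos), Q a
     polynomial (Weierstrass), that is, by a finite sine sum, whose evolution is
     explicit and tends to its first mode; the error stays small by a barrier
     built from the integrable boundary data. The amplitude of the limit is found
     from G(t) = int phi sin: comparison with explicit solutions having constant
     boundary values shows G' = (pi/l) (mu0 + mu1). *)

(** * Parabolic maximum principle *)

(** Regularity shapes the argument: [phi] is only continuous up to the sides and up to t = 0, so
    boundary values of its x-derivative are not at hand, and its sine coefficients cannot be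
    differentiated through an integration by parts. What is known of [phi] comes from comparing it
    with explicit functions. At Phi = (pi/l)^2 no stationary supersolution is positive up to the
    ends: testing h'' + Phi h <= 0 against the sine would force h(0) + h(l) <= 0. Boundary values of
    size d feed the resonant sine mode at a rate proportional to d, so the sine part of a barrier
    has to grow like the time integral of the boundary size. It stays bounded for integrable data;
    the integrability of the derivatives enters because the part of the barrier that dominates the
    boundary values must follow their variation. Comparison yields that a limit amplitude exists but
    not its value, which is why the amplitude is identified separately. *)

Lemma is_derive1P (R : realType) (f : R -> R) (x d : R) :
  is_derive x 1 f d -> forall e, 0 < e ->
  exists2 del, 0 < del & forall h, h != 0 -> `|h| < del ->
    `|(f (x + h) - f x) / h - d| < e.
Proof.
move=> [df dE] e e0.
have : (fun h => h^-1 *: ((f \o shift x) (h *: (1 : R)) - f x)) h @[h --> 0^'] --> d.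
  by rewrite -dE; exact: df.
move=> /cvgrPdist_lt /(_ e e0) => -[del /= del0 H].
exists del => // h h0 hdel.
have := H h; rewrite /= sub0r normrN => /(_ hdel h0).
by rewrite distrC /= /GRing.scale/= mulr1 (addrC h) [X in `|X - _|]mulrC.
Qed.

(** Only left difference quotients are used: in the maximum principle the maximising time may be the
    final one of the compact rectangle. *)
Lemma left_max_derive_ge0 (R : realType) (f : R -> R) (a x d : R) :
  a < x -> is_derive x 1 f d -> (forall y, a < y <= x -> f y <= f x) -> 0 <= d.
Proof.
move=> ax fd fmax; rewrite leNgt; apply/negP => d0.
have [del del0 H] := is_derive1P _ _ _ _ fd (- d) ltac:(by rewrite oppr_gt0).
pose h := Num.min (del / 2) ((x - a) / 2).
have h0 : 0 < h by rewrite lt_min; apply/andP; split; lra.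
have hdel : h < del by rewrite gt_min; apply/orP; left; lra.
have hax : h < x - a by rewrite gt_min; apply/orP; right; lra.
have := H (- h); rewrite oppr_eq0 gt_eqF// normrN gtr0_norm// => /(_ isT hdel).
have fx : f (x - h) <= f x by apply: fmax; apply/andP; split; lra.
rewrite ltr_norml => /andP[_].
have : 0 <= (f (x - h) - f x) / - h.
  by rewrite invrN mulrN -mulNr; apply: divr_ge0; lra.
lra.
Qed.

(** At the interior maximum [f' x = 0]; a positive [h] would make [f'] positive just to the right of
    [x], and the mean value theorem would push [f] above its maximum. *)
Lemma max_second_derive_le0 (R : realType) (f f' : R -> R) (a b x h : R) :
  a < x < b -> (forall y, a < y < b -> is_derive y 1 f (f' y)) ->
  is_derive x 1 f' h -> (forall y, a < y < b -> f y <= f x) -> h <= 0.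
Proof.
move=> /andP[ax xb] fd f'd fmax; rewrite leNgt; apply/negP => h0.
have f'x : f' x = 0.
  have d1 : is_derive x 1 f 0.
    apply: (@derive1_at_max _ f a b); rewrite ?in_itv/= ?ax//.
    + by rewrite ltW// (lt_trans ax).
    + by move=> t; rewrite in_itv/= => /fd[].
  have [] := fd x; first by rewrite ax xb.
  by move=> _ <-; case: d1 => _ ->.
have [del del0 H] := is_derive1P _ _ _ _ f'd _ h0.
pose k := Num.min (del / 2) ((b - x) / 2).
have k0 : 0 < k by rewrite lt_min; apply/andP; split; lra.
have kdel : k < del by rewrite gt_min; apply/orP; left; lra.
have kbx : k < b - x by rewrite gt_min; apply/orP; right; lra.
have [|y||c] := @MVT R f f' x (x + k).
- lra.
- by rewrite in_itv/= => /andP[? ?]; apply: fd; apply/andP; split; lra.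
- apply: derivable_within_continuous => y; rewrite in_itv/= => /andP[? ?].
  by apply: ex_derive; apply: fd; apply/andP; split; lra.
- rewrite in_itv/= => /andP[xc cx] E.
  have fk : f (x + k) <= f x by apply: fmax; apply/andP; split; lra.
  have := H (c - x); rewrite subr_eq0 gt_eqF// gtr0_norm ?subr_gt0//.
  move=> /(_ isT ltac:(lra)); rewrite (addrC x (c - x)) subrK f'x subr0 ltr_norml => /andP[+ _].
  have : f' c / (c - x) <= 0.
    rewrite pmulr_lle0 ?invr_gt0; last lra.
    rewrite -(pmulr_lle0 _ k0); move: E; have -> : x + k - x = k by ring.
    lra.
  lra.
Qed.

Section DerivationRules.
Context {R : realType}.
Implicit Types (f g : R -> R) (x a b k : R).

(** Separates differentiation from algebra: instance inference or an explicit rule supplies some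
    form of the derivative, and what remains is an identity for [ring] or [field]. *)
Lemma der_eq {f x a} b : is_derive x 1 f a -> a = b -> is_derive x 1 f b.
Proof. by move=> ? <-. Qed.

Lemma der_cst k x : is_derive x 1 (fun _ : R => k) 0.
Proof. exact: is_derive_cst. Qed.

Lemma der_id x : is_derive x 1 (fun y : R => y) 1.
Proof. exact: is_derive_id. Qed.

Lemma derD {f g x a b} : is_derive x 1 f a -> is_derive x 1 g b ->
  is_derive x 1 (fun y => f y + g y) (a + b).
Proof. exact: is_deriveD. Qed.

Lemma derB {f g x a b} : is_derive x 1 f a -> is_derive x 1 g b ->
  is_derive x 1 (fun y => f y - g y) (a - b).
Proof. exact: is_deriveB. Qed.

Lemma derN {f x a} : is_derive x 1 f a -> is_derive x 1 (fun y => - f y) (- a).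
Proof. exact: is_deriveN. Qed.

Lemma derM {f g x a b} : is_derive x 1 f a -> is_derive x 1 g b ->
  is_derive x 1 (fun y => f y * g y) (a * g x + f x * b).
Proof.
move=> fd gd; apply: (der_eq _ (@is_deriveM _ _ _ _ _ _ _ _ fd gd)).
by rewrite /GRing.scale/=; ring.
Qed.

Lemma der_comp {f g x a b} : is_derive (g x) 1 f a -> is_derive x 1 g b ->
  is_derive x 1 (fun y => f (g y)) (a * b).
Proof. exact: is_derive1_comp. Qed.

Lemma der_exp {g x b} n : is_derive x 1 g b ->
  is_derive x 1 (fun y => g y ^+ n.+1) (n.+1%:R * g x ^+ n * b).
Proof.
move=> gd; elim: n => [|n IH]; first by apply: (der_eq _ gd); ring.
under eq_fun do rewrite exprS.
by apply: (der_eq _ (derM gd IH)); rewrite exprS -(@natr1 R n.+1); ring.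
Qed.

Lemma der_continuous {f x a} : is_derive x 1 f a -> {for x, continuous f}.
Proof.
by move=> fd; apply/differentiable_continuous/derivable1_diffP/ex_derive; exact: fd.
Qed.

Lemma der1E {f x a} : is_derive x 1 f a -> derive1 f x = a.
Proof. by rewrite derive1E => /@derive_val. Qed.

End DerivationRules.

Definition strip {R : realType} (T a b : R) : set (R * R) :=
  [set z | T <= z.1 /\ a <= z.2 <= b].

(** The source [r] makes one notion serve for solutions, subsolutions and supersolutions, told apart
    by the sign of [r]. The derivatives are existentially quantified, so that sums, multiples and
    translates are handled by giving witnesses; nothing is asked of them on the parabolic
    boundary. *)
Definition parabolic {R : realType} (c T a b : R) (u r : R -> R -> R) : Prop :=
  {within strip T a b, continuous (fun z : R * R => u z.1 z.2)} /\
  exists ut ux uxx : R -> R -> R, forall t x, T < t -> a < x < b ->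
    [/\ is_derive t 1 (u^~ x) (ut t x), is_derive x 1 (u t) (ux t x),
        is_derive x 1 (ux t) (uxx t x) & ut t x = uxx t x + c * u t x + r t x].

Lemma within_continuous_comp {T U V : topologicalType} (A : set T) (B : set U)
    (f : T -> U) (g : U -> V) : (forall x, A x -> B (f x)) ->
  {within A, continuous f} -> {within B, continuous g} ->
  {within A, continuous (fun x => g (f x))}.
Proof.
move=> AB /subspace_continuousP fc /subspace_continuousP gc.
apply/subspace_continuousP => x Ax P /(gc _ (AB _ Ax)) H.
apply: (@filterS _ (nbhs x) _ _ _ _ (fc _ Ax _ H)) => y yP Ay.
exact: yP (AB _ Ay).
Qed.

Section Parabolic.
Context {R : realType}.
Implicit Types (c T a b k : R) (u v r s : R -> R -> R).

Lemma parabolicD {c T a b u v r s} : parabolic c T a b u r -> parabolic c T a b v s ->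
  parabolic c T a b (fun t x => u t x + v t x) (fun t x => r t x + s t x).
Proof.
move=> [uc [ut [ux [uxx uH]]]] [vc [vt [vx [vxx vH]]]]; split.
  by move=> z; apply: cvgD; [exact: uc|exact: vc].
exists (fun t x => ut t x + vt t x), (fun t x => ux t x + vx t x),
  (fun t x => uxx t x + vxx t x) => t x Tt axb.
have [u1 u2 u3 u4] := uH t x Tt axb; have [v1 v2 v3 v4] := vH t x Tt axb.
split; [exact: derD|exact: derD|exact: derD|].
by rewrite u4 v4; ring.
Qed.

Lemma parabolicZ k {c T a b u r} : parabolic c T a b u r ->
  parabolic c T a b (fun t x => k * u t x) (fun t x => k * r t x).
Proof.
move=> [uc [ut [ux [uxx uH]]]]; split.
  by move=> z; apply: cvgMr; exact: uc.
exists (fun t x => k * ut t x), (fun t x => k * ux t x),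
  (fun t x => k * uxx t x) => t x Tt axb.
have [u1 u2 u3 u4] := uH t x Tt axb.
split; [exact: is_deriveZ|exact: is_deriveZ|exact: is_deriveZ|].
by rewrite u4; ring.
Qed.

Lemma parabolicB {c T a b u v r s} : parabolic c T a b u r -> parabolic c T a b v s ->
  parabolic c T a b (fun t x => u t x - v t x) (fun t x => r t x - s t x).
Proof.
move=> uP vP; have := parabolicD uP (parabolicZ (- 1) vP).
by under [X in parabolic _ _ _ _ X _]eq_fun do
  [under eq_fun do rewrite mulN1r]; under [X in parabolic _ _ _ _ _ X]eq_fun do
  [under eq_fun do rewrite mulN1r].
Qed.

Lemma parabolicW {c T a b T' a' b' u r} : T <= T' -> a <= a' -> b' <= b ->
  parabolic c T a b u r -> parabolic c T' a' b' u r.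
Proof.
move=> TT' aa' bb' [uc [ut [ux [uxx uH]]]]; split.
  apply: continuous_subspaceW uc => -[t x] [/= Tt /andP[ax xb]].
  by split; [exact: le_trans Tt|rewrite (le_trans aa')// (le_trans xb)].
exists ut, ux, uxx => t x Tt /andP[ax xb]; apply: uH.
  exact: le_lt_trans Tt.
by rewrite (le_lt_trans aa')// (lt_le_trans xb).
Qed.

Lemma parabolic_ext {c T a b u v r s} : (forall t x, u t x = v t x) ->
  (forall t x, r t x = s t x) ->
  parabolic c T a b u r -> parabolic c T a b v s.
Proof.
move=> uv rs; have -> : u = v by apply/funext => t; apply/funext.
by have -> : r = s by apply/funext => t; apply/funext.
Qed.

(** All explicit comparison functions are sums of such products; whatever fails to solve the
    equation is put into the source. The time factor need only be continuous at [T], which admits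
    factors built from antiderivatives on a closed half-line. *)
Lemma parabolicM c T a b (e e' f f' f'' : R -> R) :
  {within `[T, +oo[, continuous e} -> (forall t : R, T < t -> is_derive t 1 e (e' t)) ->
  (forall x : R, is_derive x 1 f (f' x)) -> (forall x : R, is_derive x 1 f' (f'' x)) ->
  parabolic c T a b (fun t x => e t * f x)
    (fun t x => e' t * f x - e t * (f'' x + c * f x)).
Proof.
move=> ec ed fd f'd; split.
  have fc : continuous f.
    by move=> x; exact: der_continuous (fd x).
  move=> z; apply: cvgM; last first.
    apply: (@continuous_subspaceT _ _ _ (fun z : R * R => f z.2)).
    by move=> y; apply: continuous_comp; [exact: cvg_snd|exact: fc].
  move: z; apply: (@within_continuous_comp _ _ _ _ `[T, +oo[%classic fst e) => //.
  - by move=> [t x] [/= Tt _]; rewrite in_itv/= Tt.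
  - by apply: continuous_subspaceT => y; exact: cvg_fst.
exists (fun t x => e' t * f x), (fun t x => e t * f' x), (fun t x => e t * f'' x).
move=> t x Tt _; split.
- by apply: (der_eq _ (derM (ed t Tt) (der_cst (f x) t))); ring.
- exact: is_deriveZ.
- exact: is_deriveZ.
- ring.
Qed.

(** The weight exp(-(c+1)t) turns the zeroth-order coefficient into -1 whatever the sign of [c]. At
    a positive maximum of the weighted function, which must lie off the parabolic boundary, its time
    derivative is then the weight times uxx + r - u < 0, against the left-sided maximum in time. *)
Lemma parabolic_max_le0 c T a b u r t1 : parabolic c T a b u r -> T <= t1 ->
  (forall t x, T < t -> a < x < b -> r t x <= 0) ->
  (forall x, a <= x <= b -> u T x <= 0) ->
  (forall t, T <= t <= t1 -> u t a <= 0 /\ u t b <= 0) ->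
  forall x, a <= x <= b -> u t1 x <= 0.
Proof.
move=> [uc [ut [ux [uxx uH]]]] Tt1 r0 uT uab x1 ax1b.
rewrite leNgt; apply/negP => u1.
pose K := `[T, t1]%classic `*` `[a, b]%classic.
pose f (z : R * R) := expR (- (c + 1) * z.1) * u z.1 z.2.
have K0 : K !=set0 by exists (t1, x1); split; rewrite /= in_itv/= ?Tt1 ?lexx.
have Kc : compact K by apply: compact_setX; exact: segment_compact.
have fc : {within K, continuous f}.
  move=> z; apply: cvgM.
    apply: (@continuous_subspaceT _ _ K (fun z : R * R => expR (- (c + 1) * z.1))).
    move=> y; apply: continuous_comp; last exact: continuous_expR.
    by apply: cvgMr; exact: cvg_fst.
  move: z; apply: continuous_subspaceW uc => -[t x] [/=].
  by rewrite !in_itv/= => /andP[? _] ?.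
have [[t0 x0]] := compact_EVT_max K0 Kc fc.
rewrite inE /K /= !in_itv/= => -[/andP[Tt0 t01] ax0b] fmax.
have u0 : 0 < u t0 x0.
  have := fmax (t1, x1); rewrite inE /K/= !in_itv/= Tt1 lexx ax1b => /(_ (conj isT isT)).
  rewrite /f/= => H; rewrite -(pmulr_rgt0 _ (expR_gt0 (- (c + 1) * t0))).
  by apply: lt_le_trans H; rewrite mulr_gt0 ?expR_gt0.
have Tt : T < t0.
  rewrite lt_neqAle Tt0 andbT; apply/eqP => E; move: u0.
  by rewrite -E ltNge uT.
have axb : a < x0 < b.
  move: ax0b => /andP[ax xb]; rewrite !lt_neqAle ax xb !andbT.
  have [ua ub] : u t0 a <= 0 /\ u t0 b <= 0 by apply: uab; rewrite Tt0.
  apply/andP; split; apply/eqP => E; move: u0; rewrite ltNge.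
    by rewrite -E ua.
  by rewrite E ub.
have [u1' u2 u3 u4] := uH _ _ Tt axb.
have uxx0 : uxx t0 x0 <= 0.
  apply: (@max_second_derive_le0 _ (u t0) (ux t0) a b x0) => //.
    by move=> y ayb; have [] := uH _ _ Tt ayb.
  move=> y /andP[ay yb].
  have := fmax (t0, y); rewrite inE /K/= !in_itv/= Tt0 t01 (ltW ay) (ltW yb) => /(_ (conj isT isT)).
  by rewrite /f/= ler_pM2l ?expR_gt0.
have : 0 <= expR (- (c + 1) * t0) * (ut t0 x0 - (c + 1) * u t0 x0).
  apply: (@left_max_derive_ge0 _ (fun t => f (t, x0)) T t0 _ Tt).
    apply: der_eq; rewrite /GRing.scale/=; ring.
  move=> y /andP[Ty yt]; apply: fmax; rewrite inE /K/= !in_itv/=.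
  by rewrite (ltW Ty) (le_trans yt t01) ax0b.
rewrite pmulr_rge0 ?expR_gt0// u4; have := r0 _ _ Tt axb; lra.
Qed.

End Parabolic.

(** * Comparison, divergence and subcritical convergence *)

Section Comparison.
Context {R : realType}.
Implicit Types (c T a b k l : R) (u v r s : R -> R -> R).

Lemma parabolic_le c T a b u v r s t1 : parabolic c T a b u r -> parabolic c T a b v s ->
  T <= t1 ->
  (forall t x, T < t -> a < x < b -> r t x <= s t x) ->
  (forall x, a <= x <= b -> u T x <= v T x) ->
  (forall t, T <= t <= t1 -> u t a <= v t a /\ u t b <= v t b) ->
  forall x, a <= x <= b -> u t1 x <= v t1 x.
Proof.
move=> uP vP Tt1 rs uvT uvab x axb; rewrite -subr_le0.
apply: (@parabolic_max_le0 _ c T a b _ _ t1 (parabolicB uP vP)) => //.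
- by move=> ? ? ? ?; rewrite subr_le0 rs.
- by move=> ? ?; rewrite subr_le0 uvT.
- by move=> ? ?; rewrite !subr_le0; exact: uvab.
Qed.

Lemma parabolic_norm_le c T a b u v s t1 : parabolic c T a b u (fun _ _ => 0) ->
  parabolic c T a b v s -> T <= t1 ->
  (forall t x, T < t -> a < x < b -> 0 <= s t x) ->
  (forall x, a <= x <= b -> `|u T x| <= v T x) ->
  (forall t, T <= t <= t1 -> `|u t a| <= v t a /\ `|u t b| <= v t b) ->
  forall x, a <= x <= b -> `|u t1 x| <= v t1 x.
Proof.
move=> uP vP Tt1 s0 uvT uvab x axb; rewrite ler_norml lerNl; apply/andP; split.
  rewrite -mulN1r.
  apply: (@parabolic_le c T a b _ _ _ _ t1 (parabolicZ (- 1) uP) vP) => //=.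
  - by move=> ? ? ? ?; rewrite mulr0 s0.
  - by move=> y /uvT; rewrite mulN1r -normrN; apply: le_trans; exact: ler_norm.
  - by move=> y /uvab[ua ub]; split; rewrite mulN1r;
      [apply: le_trans ua|apply: le_trans ub]; rewrite -normrN ler_norm.
apply: (@parabolic_le c T a b _ _ _ _ t1 uP vP) => //=.
- by move=> y /uvT; apply: le_trans; rewrite ler_norm.
- by move=> y /uvab[ua ub]; split;
    [apply: le_trans ua|apply: le_trans ub]; rewrite ler_norm.
Qed.

Lemma strip_section_continuous {T a b u t} : T <= t ->
  {within strip T a b, continuous (fun z : R * R => u z.1 z.2)} ->
  {within `[a, b], continuous (u t)}.
Proof.
move=> Tt; apply: (@within_continuous_comp _ _ _ `[a, b] (strip T a b) (pair t)).
  by move=> x /=; rewrite in_itv/=.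
apply: continuous_subspaceT => x.
exact: (@cvg_pair _ _ _ _ _ _ _ _ _ (fun=> t) id (cvg_cst t) cvg_id).
Qed.

Lemma within_continuous_bounded (f : R -> R) a b : a <= b ->
  {within `[a, b], continuous f} ->
  exists2 B, 0 <= B & forall x, a <= x <= b -> `|f x| <= B.
Proof.
move=> ab fc; have fc' : {within `[a, b], continuous (fun x => `|f x|)}.
  by move=> x; apply: cvg_norm; exact: fc.
have [y _ ymax] := EVT_max ab fc'; by exists `|f y|.
Qed.

(** The threshold is made nonnegative because the data are controlled for t >= 0 only. *)
Lemma cvgyP (f : R -> R) (L : R) : (f t @[t --> +oo] --> L) <->
  forall e, 0 < e -> exists2 M, 0 <= M & forall t, M <= t -> `|f t - L| < e.
Proof.
split.
  move=> /cvgrPdist_lt H e /H [M [_ HM]]; exists (Num.max 0 (M + 1)).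
    by rewrite le_max lexx.
  move=> t; rewrite ge_max => /andP[_ Mt]; rewrite distrC; apply: HM; lra.
move=> H; apply/cvgrPdist_lt => e /H [M M0 HM]; exists M; split.
  exact: num_real.
by move=> t Mt; rewrite distrC; apply: HM; exact: ltW.
Qed.

Lemma metrics_convergeP l (phi : R -> R -> R) (w : R -> R) :
  metrics_converge l phi w <->
  forall e, 0 < e -> exists2 M, 0 <= M &
    forall t x, M <= t -> 0 <= x <= l -> `|phi t x - w x| < e.
Proof.
split.
  move=> H e e0.
  have /H[M [_ HM]] : nbhs (w : {uniform` `[0, l]%classic -> R})
      [set h | forall x, 0 <= x <= l -> `|h x - w x| < e].
    apply/uniform_nbhs; exists [set z | ball z.1 e z.2]; split.
      by rewrite -entourage_ballE; exists e.
    move=> h /= hw x xl; rewrite distrC; apply: (hw x).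
    by rewrite in_itv.
  exists (Num.max 0 (M + 1)); first by rewrite le_max lexx.
  move=> t x; rewrite ge_max => /andP[_ Mt]; apply: HM; lra.
move=> H P /uniform_nbhs[E [+ EP]]; rewrite -entourage_ballE => -[e /= e0 eE].
have [M M0 HM] := H e e0; exists M; split; first exact: num_real.
move=> t Mt; apply: EP => /= x; rewrite in_itv/= => xl.
by apply: eE => /=; rewrite /ball /= distrC HM// ltW.
Qed.

Lemma classical_parabolic l Phi (phi : R -> R -> R) :
  classical_regularity l phi -> heat_equation l Phi phi ->
  parabolic Phi 0 0 l phi (fun _ _ => 0).
Proof.
move=> [phic phid] heat; split; first exact: phic.
exists (fun t x => derive1 (phi^~ x) t), (fun t x => derive1 (phi t) x),
  (fun t x => derive1n 2 (phi t) x) => t x t0 xl.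
have [[d1 d2 d3] _] := phid t x t0 xl.
split.
- by rewrite derive1E; exact: DeriveDef.
- by rewrite derive1E; exact: DeriveDef.
- by rewrite derive1nS derive1n1 derive1E; exact: DeriveDef.
- by rewrite heat// addr0.
Qed.

Lemma supercritical_divergence l Phi (phi : R -> R -> R) : 0 < l ->
  parabolic Phi 0 0 l phi (fun _ _ => 0) ->
  (forall t x, 0 <= t -> 0 < x < l -> 0 < phi t x) ->
  (pi / l) ^+ 2 < Phi -> metrics_diverge l phi.
Proof.
move=> l0 phiP phi_gt0 Phil [w /metrics_convergeP wP].
have pi0 := pi_gt0 R.
have Phi0 : 0 < Phi by apply: le_lt_trans Phil; rewrite sqr_ge0.
have sl : pi / Num.sqrt Phi < l.
  rewrite ltr_pdivrMr ?sqrtr_gt0// mulrC -ltr_pdivrMr//.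
  by rewrite -[_ < _](@ltr_pXn2r _ 2%N)// ?nnegrE ?sqrtr_ge0 ?divr_ge0 ?ltW// sqr_sqrtr// ltW.
have s0 : 0 < pi / Num.sqrt Phi by rewrite divr_gt0// sqrtr_gt0.
(* Midway between the critical length pi / sqrt Phi and l: the first Dirichlet eigenvalue [om ^+ 2]
   of an interval of length [L] is still below Phi. *)
pose L := (pi / Num.sqrt Phi + l) / 2.
have L0 : 0 < L by rewrite /L; lra.
have Ll : L < l by rewrite /L; lra.
pose om := pi / L; pose lam := Phi - om ^+ 2.
have om0 : 0 < om by rewrite divr_gt0.
have lam0 : 0 < lam.
  rewrite subr_gt0 -[ltRHS]sqr_sqrtr ?ltW// ltr_pXn2r ?nnegrE ?sqrtr_ge0 ?ltW//.
  rewrite ltr_pdivrMr// mulrC -ltr_pdivrMr ?sqrtr_gt0// /L; lra.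
pose eta := (l - L) / 2.
have eta0 : 0 < eta by rewrite /eta; lra.
have etal : l - eta = eta + L by rewrite /eta; lra.
have [x0 x0l x0min] : exists2 x0, x0 \in `[eta, l - eta] &
    forall x, x \in `[eta, l - eta] -> phi 0 x0 <= phi 0 x.
  apply: EVT_min; first lra.
  apply: (strip_section_continuous (lexx (0 : R))).
  apply: continuous_subspaceW phiP.1 => -[t x] [/= t0 ?]; split => //=; lra.
(* The minimum is taken over the centred segment of length [L], away from the ends, because [phi 0]
   may vanish at 0 and at l. *)
pose eps := phi 0 x0.
have eps0 : 0 < eps.
  by apply: phi_gt0 => //; move: x0l; rewrite in_itv/=; lra.
pose f x := sin (om * (x - eta)).
have ed (t : R) :
    is_derive t 1 (fun t => eps * expR (lam * t)) (eps * (expR (lam * t) * lam)).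
  by apply: der_eq; rewrite /GRing.scale/=; ring.
have vP : parabolic Phi 0 eta (l - eta) (fun t x => eps * expR (lam * t) * f x)
    (fun _ _ => 0).
  apply: parabolic_ext; last first.
    apply: (@parabolicM _ Phi 0 eta (l - eta) _
      (fun t => eps * (expR (lam * t) * lam)) f (fun x => cos (om * (x - eta)) * om)
      (fun x => - sin (om * (x - eta)) * om * om)).
    - by apply: continuous_subspaceT => t; exact: der_continuous (ed t).

    - by move=> x; rewrite ?/f ?/s; apply: der_eq; rewrite /GRing.scale/=; ring.
    - by move=> x; rewrite ?/f ?/s; apply: der_eq; rewrite /GRing.scale/=; ring.
  - by move=> t x; rewrite /f /lam /=; ring.
  - by [].
have main t : 0 <= t -> eps * expR (lam * t) <= phi t (l / 2).
  move=> t0.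
  have -> : eps * expR (lam * t) = eps * expR (lam * t) * f (l / 2).
    rewrite /f; have -> : om * (l / 2 - eta) = pi / 2.
      by rewrite /om /eta; field; rewrite gt_eqF.
    by rewrite sin_pihalf mulr1.
  have phiP' := parabolicW (lexx 0) (ltW eta0) (_ : l - eta <= l) phiP.
  apply: (@parabolic_le Phi 0 eta (l - eta) _ _ _ _ t vP (phiP' _)) => //; try lra.
  - move=> x xl; rewrite mulr0 expR0 mulr1 (@le_trans _ _ eps)//.
      by rewrite ger_pMr// sin_le1.
    by apply: x0min; rewrite in_itv.
  - move=> t' /andP[t'0 _]; rewrite /f subrr mulr0 sin0 mulr0 etal addrAC subrr add0r.
    rewrite /om mulfVK ?gt_eqF// sinpi mulr0.
    by split; apply: ltW; apply: phi_gt0 => //; lra.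
have [M M0 HM] := wP 1 ltr01.
(* At this time lam * eps * t1 >= |w(l/2)| + 1, so exp(y) >= 1 + y already lifts the subsolution
   above w(l/2) + 1, contradicting convergence at the midpoint. *)
have := main (Num.max M ((`|w (l / 2)| + 1) / (lam * eps))).
set t1 := Num.max _ _; have Mt : M <= t1 by rewrite le_max lexx.
have wt : (`|w (l / 2)| + 1) / (lam * eps) <= t1 by rewrite le_max lexx orbT.
move=> /(_ (le_trans M0 Mt)).
have := HM t1 (l / 2) Mt ltac:(apply/andP; split; lra).
have := expR_ge1Dx (lam * t1); rewrite ltr_norml.
move: wt; rewrite ler_pdivrMr ?mulr_gt0//.
have := ler_norm (w (l / 2)).
move=> h1 h2 h3 /andP[_ h4] h5.
have : eps * (1 + lam * t1) <= eps * expR (lam * t1) by rewrite ler_pM2l.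
nra.
Qed.

Lemma expR_decay (k C e : R) : 0 < k -> 0 <= C -> 0 < e ->
  exists2 M, 0 <= M & forall t, M <= t -> C * expR (- k * t) < e.
Proof.
move=> k0 C0 e0; exists (C / (e * k)); first by rewrite divr_ge0// mulr_ge0// ltW.
move=> t; rewrite ler_pdivrMr ?mulr_gt0// => Ct.
rewrite mulNr expRN ltr_pdivrMr ?expR_gt0//.
have := expR_ge1Dx (k * t) => h.
have : e * (1 + k * t) <= e * expR (k * t) by rewrite ler_pM2l.
lra.
Qed.

(** Since w'' = - Phi w, the difference phi - w solves the same homogeneous equation. The barrier is
    (C exp(-k t) + e/2) s(x): the decaying term covers the profile at time [T], the constant term
    covers the small boundary values after [T]. *)
Lemma subcritical_convergence l Phi (phi : R -> R -> R) (w w' : R -> R) : 0 < l ->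
  parabolic Phi 0 0 l phi (fun _ _ => 0) -> Phi < (pi / l) ^+ 2 ->
  (forall x : R, is_derive x 1 w (w' x)) ->
  (forall x : R, is_derive x 1 w' (- Phi * w x)) ->
  phi t 0 @[t --> +oo] --> w 0 -> phi t l @[t --> +oo] --> w l ->
  metrics_converge l phi w.
Proof.
move=> l0 phiP Phil wd w'd /cvgyP lim0 /cvgyP lim1.
have pi0 := pi_gt0 R.
have pil0 : 0 < pi / l by rewrite divr_gt0.
(* The maximum with 0 keeps [q] positive, so that it has a square root also when Phi <= 0. *)
pose q := (Num.max 0 Phi + (pi / l) ^+ 2) / 2.
have ql : q < (pi / l) ^+ 2.
  have : Num.max 0 Phi < (pi / l) ^+ 2 by rewrite gt_max Phil exprn_gt0.
  by rewrite /q; lra.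
have q0 : 0 < q.
  have : 0 <= Num.max 0 Phi by rewrite le_max lexx.
  by have := exprn_gt0 2 pil0; rewrite /q; lra.
have Phiq : Phi < q.
  have : Phi <= Num.max 0 Phi by rewrite le_max lexx orbT.
  by rewrite /q; lra.
pose om := Num.sqrt q; have om0 : 0 < om by rewrite sqrtr_gt0.
have om2 : om ^+ 2 = q by rewrite sqr_sqrtr// ltW.
have oml : om < pi / l.
  by rewrite -(@ltr_pXn2r _ 2%N)// ?nnegrE ?ltW// om2.
pose s x := cos (om * (x - l / 2)); pose s0 := cos (om * l / 2).
have oml2 : om * l < pi by rewrite -ltr_pdivlMr.
have s00 : 0 < s0.
  by apply: cos_gt0_pihalf; have := mulr_gt0 om0 l0; lra.
have ss0 x : 0 <= x <= l -> s0 <= s x.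
  move=> /andP[x0 xl]; rewrite /s /s0 -[X in _ <= X]cos_norm.
  have ml := mulr_gt0 om0 l0.
  have yl : `|om * (x - l / 2)| <= om * l / 2.
    by rewrite normrM gtr0_norm// -mulrA ler_pM2l// ler_norml; lra.
  rewrite leNgt ltr_cos ?in_itv/= -?leNgt ?normr_ge0//=; lra.
have s1 x : s x <= 1 by exact: cos_le1.
pose k := q - Phi; have k0 : 0 < k by rewrite /k; lra.
have wP T : parabolic Phi T 0 l (fun t x => 1 * w x) (fun _ _ => 0).
  apply: parabolic_ext; last first.
    apply: (@parabolicM _ Phi T 0 l (fun=> 1) (fun=> 0) w w' (fun x => - Phi * w x)) => //.
    by apply: continuous_subspaceT => t; exact: cvg_cst.
  - by move=> t x /=; ring.
  - by [].
apply/metrics_convergeP => e e0.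
(* Since [s] is at least [s0] at the ends, boundary errors below e * s0 / 2 lie under the constant
   part (e/2) s of the barrier. *)
have eps0 : 0 < e * s0 / 2 by rewrite divr_gt0// mulr_gt0.
have [T0 T00 HT0] := lim0 _ eps0; have [T1 T10 HT1] := lim1 _ eps0.
pose T := Num.max T0 T1.
have T0T : T0 <= T by rewrite le_max lexx.
have T1T : T1 <= T by rewrite le_max lexx orbT.
have TT0 : 0 <= T by exact: le_trans T0T.
have phiTP := parabolicW TT0 (lexx 0) (lexx l) phiP.
have [B B0 HB] : exists2 B, 0 <= B & forall x, 0 <= x <= l -> `|phi T x - w x| <= B.
  apply: within_continuous_bounded; first exact: ltW.
  move=> x; apply: cvgB; first exact: (strip_section_continuous TT0 phiP.1).
  move: x; apply: continuous_subspaceT => x; exact: der_continuous (wd x).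
(* Normalised so that C exp(-k T) s0 = B, the bound for the profile at time [T]. *)
pose C := B / s0 * expR (k * T).
have C0 : 0 <= C by rewrite mulr_ge0 ?expR_ge0// divr_ge0// ltW.
have sP T' : forall (e1 e1' : R -> R), {within `[T', +oo[, continuous e1} ->
   (forall t : R, T' < t -> is_derive t 1 e1 (e1' t)) ->
   parabolic Phi T' 0 l (fun t x => e1 t * s x) (fun t x => (e1' t + k * e1 t) * s x).
  move=> e1 e1' e1c e1d.
  apply: parabolic_ext; last first.
    apply: (@parabolicM _ Phi T' 0 l e1 e1' s (fun x => - sin (om * (x - l / 2)) * om)
      (fun x => - cos (om * (x - l / 2)) * om * om)) => //.
    - by move=> x; rewrite ?/f ?/s; apply: der_eq; rewrite /GRing.scale/=; ring.
    - by move=> x; rewrite ?/f ?/s; apply: der_eq; rewrite /GRing.scale/=; ring.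
  - by move=> t x /=; rewrite /s /k -om2; ring.
  - by [].
pose e1 t := C * expR (- k * t) + e / 2.
have ed (t : R) : is_derive t 1 e1 (C * (expR (- k * t) * - k)).
  by rewrite /e1; apply: der_eq; rewrite /GRing.scale/=; ring.
have vP := sP T e1 _ (continuous_subspaceT (fun t => der_continuous (ed t)))
  (fun t _ => ed t).
have uP : parabolic Phi T 0 l (fun t x => phi t x - 1 * w x) (fun _ _ => 0).
  by apply: (parabolic_ext _ _ (parabolicB phiTP (wP T))) => // ? ?; rewrite subr0.
have [M M0 HM] := expR_decay k C (e / 2) k0 C0 ltac:(lra).
exists (Num.max T M); first by rewrite le_max TT0.
move=> t x; rewrite ge_max => /andP[Tt Mt] xl.
have E1 : `|phi t x - 1 * w x| <= (C * expR (- k * t) + e / 2) * s x.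
  apply: (parabolic_norm_le _ _ _ _ _ _ _ _ uP vP) => //.
  - move=> t' x' Tt' /andP[x0 xl']; rewrite mulr_ge0//.
      have -> : C * (expR (- k * t') * - k) + k * e1 t' = k * (e / 2).
        by rewrite /e1; ring.
      by rewrite mulr_ge0 ?ltW//; lra.
    by rewrite (le_trans (ltW s00))// ss0// !ltW.
  - move=> x' xl'; rewrite mul1r (le_trans (HB _ xl'))// /e1.
    have -> : C * expR (- k * T) = B / s0.
      by rewrite /C -mulrA -expRD mulNr subrr expR0 mulr1.
    apply: (@le_trans _ _ (B / s0 * s0)); first by rewrite divfK// gt_eqF.
    have Bs := divr_ge0 B0 (ltW s00).
    apply: ler_pM; [by []|exact: ltW|lra|exact: ss0].
  - have aux y z : `|y| < e * s0 / 2 -> s0 <= z -> forall t', `|y| <= (C * expR (- k * t') + e / 2) * z.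
      move=> h hz t'; apply: ltW; apply: (lt_le_trans h).
      have := mulr_ge0 C0 (expR_ge0 (- k * t')) => h1.
      have : 0 <= (C * expR (- k * t')) * z by rewrite mulr_ge0// (le_trans (ltW s00)).
      nra.
    move=> t' /andP[Tt' _]; rewrite !mul1r; split; apply: aux.
    + by apply: HT0; exact: le_trans T0T Tt'.
    + by apply: ss0; rewrite lexx ltW.
    + by apply: HT1; exact: le_trans T1T Tt'.
    + by apply: ss0; rewrite lexx ltW.
have := HM t Mt; rewrite mul1r in E1 => h; apply: (le_lt_trans E1).
have h1 := mulr_ge0 C0 (expR_ge0 (- k * t)).
have : (C * expR (- k * t) + e / 2) * s x <= C * expR (- k * t) + e / 2.
  by rewrite ger_pMr ?s1//; lra.
lra.
Qed.

End Comparison.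

(** * Weierstrass approximation *)

Section Weierstrass.
Context {R : realType}.
Implicit Types (f g : R -> R) (a b x e : R).

(** Composition with this retraction extends a function continuous on a segment to one continuous on
    the whole line. *)
Definition clamp a b x : R := Num.max a (Num.min b x).

Lemma clamp_itv a b x : a <= b -> a <= clamp a b x <= b.
Proof. by move=> ab; rewrite /clamp le_max lexx ge_max ab ge_min lexx. Qed.

Lemma clampE a b x : a <= x <= b -> clamp a b x = x.
Proof. by move=> /andP[ax xb]; rewrite /clamp (min_idPr xb) (max_idPr ax). Qed.

Lemma continuous_funcomp {T U V : topologicalType} (h : T -> U) (k : U -> V) :
  continuous h -> continuous k -> continuous (fun z => k (h z)).
Proof. by move=> hc kc z; apply: continuous_comp; [exact: hc|exact: kc]. Qed.

Lemma clamp_continuous f a b : a <= b -> {within `[a, b], continuous f} ->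
  continuous (fun x => f (clamp a b x)).
Proof.
move=> ab fc.
have : {within setT, continuous (fun x => f (clamp a b x))}.
  apply: within_continuous_comp fc.
    by move=> x _ /=; rewrite in_itv/= clamp_itv.
  apply: continuous_subspaceT => x; apply: continuous_max; first exact: cvg_cst.
  by apply: continuous_min; [exact: cvg_cst|exact: cvg_id].
by rewrite -continuous_subspace_setT.
Qed.

(* Mean of [g k] for [k] binomially distributed with parameters [n] and ['X]. *)
Fixpoint bernstein (n : nat) (g : nat -> R) : {poly R} :=
  if n is n'.+1 then
    'X * bernstein n' (fun k => g k.+1) + (1 - 'X) * bernstein n' g
  else (g 0%N)%:P.

Lemma bernstein_le n (g h : nat -> R) x : 0 <= x <= 1 ->
  (forall k, (k <= n)%N -> g k <= h k) ->
  (bernstein n g).[x] <= (bernstein n h).[x].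
Proof.
move=> /andP[x0 x1]; elim: n g h => [|n IH] g h gh /=; rewrite !hornerE.
  exact: gh.
apply: lerD; apply: ler_wpM2l => //; rewrite ?subr_ge0//; apply: IH => k kn.
  exact: gh.
by apply: gh; exact: leqW.
Qed.

(** Squared mean plus variance n x (1 - x) of the binomial law. The shift [a] carries the induction:
    the recursive call on k + 1 replaces [a] by a + 1. *)
Lemma bernstein_quad n (al c a x : R) :
  (bernstein n (fun k : nat => al + c * (k%:R + a) ^+ 2)).[x] =
  al + c * ((n%:R * x + a) ^+ 2 + n%:R * x * (1 - x)).
Proof.
elim: n a => [|n IH] a /=; rewrite !hornerE; first ring.
have -> : (fun k : nat => al + c * (k.+1%:R + a) ^+ 2) =
    (fun k : nat => al + c * (k%:R + (a + 1)) ^+ 2).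
  by apply/funext => k; rewrite -natr1; ring.
by rewrite !IH -natr1; ring.
Qed.

(* On the compact set of the pairs with [e <= `|f x - f y|] the quantity
   [(x - y) ^+ 2] has a positive minimum. *)
Lemma quadratic_modulus f e : continuous f -> 0 < e ->
  exists2 c, 0 <= c & forall x y, 0 <= x <= 1 -> 0 <= y <= 1 ->
    `|f x - f y| <= e + c * (x - y) ^+ 2.
Proof.
move=> fc e0.
have [B B0 fB] := within_continuous_bounded _ _ _ ler01 (continuous_subspaceT fc).
have fstc : continuous (fun z : R * R => f z.1).
  by move=> z; apply: continuous_comp; [exact: cvg_fst|exact: fc].
have sndc : continuous (fun z : R * R => f z.2).
  by move=> z; apply: continuous_comp; [exact: cvg_snd|exact: fc].
have dc : continuous (fun z : R * R => `|f z.1 - f z.2|).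
  by move=> z; apply: cvg_norm; apply: cvgB; [exact: fstc|exact: sndc].
pose K := (`[0, 1]%classic `*` `[0, 1]%classic) `&`
  ((fun z : R * R => `|f z.1 - f z.2|) @^-1` [set r | e <= r]).
have Kc : compact K.
  apply: compact_closedI.
    by apply: compact_setX; exact: segment_compact.
  by apply: closed_comp => // z _; exact: dc.
have [K0|K0] := pselect (K !=set0); last first.
  exists 0 => // x y x01 y01; rewrite mul0r addr0 leNgt; apply/negP => H.
  by apply: K0; exists (x, y); split; [split; rewrite /= in_itv|exact: ltW].
have qc : {within K, continuous (fun z : R * R => (z.1 - z.2) ^+ 2)}.
  apply: continuous_subspaceT => z; apply: (@cvgM _ _ (nbhs z)).
    by apply: cvgB; [exact: cvg_fst|exact: cvg_snd].
  by apply: cvgB; [exact: cvg_fst|exact: cvg_snd].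
have [[x0 y0]] := compact_EVT_min K0 Kc qc.
rewrite inE /K /= => -[_ exy0] mmin; pose m := (x0 - y0) ^+ 2.
have m0 : 0 < m.
  rewrite lt0r sqr_ge0 andbT; apply/eqP => /eqP; rewrite sqrf_eq0 subr_eq0 => /eqP E.
  by move: exy0; rewrite E subrr normr0 leNgt e0.
have Bm : 0 <= 2 * B / m by apply: divr_ge0; [lra|exact: ltW].
exists (2 * B / m) => //.
move=> x y x01 y01; have [exy|exy] := leP e `|f x - f y|; last first.
  by rewrite (le_trans (ltW exy))// lerDl mulr_ge0 ?sqr_ge0.
have mxy : m <= (x - y) ^+ 2.
  have /mmin : (x, y) \in K; last by [].
  by rewrite inE; split => //=; split; rewrite /= in_itv.
have : 2 * B <= 2 * B / m * (x - y) ^+ 2.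
  rewrite mulrAC ler_pdivlMr//; apply: ler_wpM2l => //; exact: mulr_ge0.
have := ler_normB (f x) (f y); have := fB _ x01; have := fB _ y01.
lra.
Qed.

(** By [quadratic_modulus] the node values lie within e/2 + c (x - k/N)^2 of f(x). The Bernstein
    operator is monotone and sends this quadratic to e/2 plus the variance c x (1 - x) / N, which is
    at most e/2 for large N. *)
Lemma weierstrass f e : continuous f -> 0 < e ->
  exists p : {poly R}, forall x, 0 <= x <= 1 -> `|f x - p.[x]| <= e.
Proof.
move=> fc e0.
have [c c0 fm] := quadratic_modulus f (e / 2) fc ltac:(lra).
have [n nc] : exists n : nat, 2 * c / e < n.+1%:R.
  exists (Num.truncn (2 * c / e)); apply: truncnS_gt.
exists (bernstein n.+1 (fun k => f (k%:R / n.+1%:R))) => x x01.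
have N0 : 0 < n.+1%:R :> R by rewrite ltr0n.
set N : R := n.+1%:R in nc N0 *.
have node (k : nat) : (k <= n.+1)%N -> 0 <= k%:R / N <= 1.
  by move=> kn; rewrite divr_ge0 ?ler0n//= ler_pdivrMr// mul1r ler_nat.
have E (k : nat) : e / 2 + c * (x - k%:R / N) ^+ 2 = e / 2 + c / N ^+ 2 * (k%:R - N * x) ^+ 2.
  by field; rewrite gt_eqF.
pose V : R := c / N ^+ 2 * ((N * x + - (N * x)) ^+ 2 + N * x * (1 - x)).
have small : V <= e / 2.
  have -> : V = c * (x * (1 - x)) / N by rewrite /V; field; rewrite gt_eqF.
  rewrite ler_pdivrMr//; move: nc; rewrite ltr_pdivrMr// => nc.
  have : c * (x * (1 - x)) <= c * 1 by apply: ler_wpM2l => //; nra.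
  lra.
rewrite ler_norml; apply/andP; split.
- have := bernstein_le n.+1 (fun k => f (k%:R / N))
    (fun k => (f x + e / 2) + c / N ^+ 2 * (k%:R + - (N * x)) ^+ 2) x x01.
  rewrite bernstein_quad -/N -/V => H.
  suff : (bernstein n.+1 (fun k => f (k%:R / N))).[x] <=
     f x + e / 2 + V by lra.
  apply: H => k kn.
  have := fm _ _ x01 (node k kn); rewrite E ler_norml.
  by set W : R := c / N ^+ 2 * _; lra.
- have := bernstein_le n.+1 
    (fun k => (f x - e / 2) + (- (c / N ^+ 2)) * (k%:R + - (N * x)) ^+ 2)
    (fun k => f (k%:R / N)) x x01.
  rewrite bernstein_quad -/N mulNr -/V => H.
  suff : f x - e / 2 - V <=
     (bernstein n.+1 (fun k => f (k%:R / N))).[x] by lra.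
  apply: H => k kn.
  have := fm _ _ x01 (node k kn); rewrite E ler_norml mulNr.
  by set W : R := c / N ^+ 2 * _; lra.
Qed.

Lemma acos_continuous : {within `[(-1), 1], continuous (@acos R)}.
Proof.
have := @segment_can_continuous R 0 pi cos acos (pi_ge0 R)
  (continuous_subspaceT (@continuous_cos R)) (@cosK R).
by rewrite cos0 cospi/= (min_idPr _) ?(max_idPl _)//; lra.
Qed.

(** Substitute v = (cos y + 1) / 2, which maps [0, pi] onto [0, 1], and approximate the pulled-back
    function by a polynomial in v. *)
Lemma weierstrass_cos f e : {within `[0, pi], continuous f} -> 0 < e ->
  exists p : {poly R}, forall y, 0 <= y <= pi -> `|f y - p.[cos y]| <= e.
Proof.
move=> fc e0.
have ac : continuous (fun v : R => acos (clamp (-1) 1 v)).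
  by apply: clamp_continuous; [lra|exact: acos_continuous].
have hc : continuous (fun v : R => f (clamp 0 pi (acos (clamp (-1) 1 (2 * v - 1))))).
  have lc : continuous (fun v : R => 2 * v - 1).
    by move=> v; apply: cvgB; [apply: cvgMr; exact: cvg_id|exact: cvg_cst].
  exact: (continuous_funcomp _ _ (continuous_funcomp _ _ lc ac)
    (clamp_continuous _ _ _ (pi_ge0 R) fc)).
have [p pP] := weierstrass _ _ hc e0.
exists (p \Po (2^-1 *: ('X + 1))) => y y0pi.
have c1 := cos_geN1 y; have c2 := cos_le1 y.
have := pP (2^-1 * (cos y + 1)) ltac:(lra).
have -> : 2 * (2^-1 * (cos y + 1)) - 1 = cos y by field.
rewrite horner_comp !hornerE.
by rewrite (clampE _ _ (cos y)) ?c1// cosK ?in_itv//= clampE.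
Qed.

End Weierstrass.

(** * Sine approximation and the first sine moment *)

Section SineApproximation.
Context {R : realType} (l : R) (l0 : 0 < l).
Implicit Types (u v g : R -> R) (k x t b e d : R).

Lemma sin_itv_gt0 x : 0 < x < l -> 0 < sin (pi * x / l).
Proof.
move=> /andP[x0 xl]; have pi0 := pi_gt0 R; apply: sin_gt0_pi.
by rewrite divr_gt0 ?mulr_gt0//= ltr_pdivrMr// ltr_pM2l.
Qed.

Lemma arg_itv x : 0 <= x <= l -> 0 <= pi * x / l <= pi.
Proof.
move=> /andP[x0 xl]; have pi0 := pi_ge0 R.
by rewrite divr_ge0 ?mulr_ge0 ?(ltW l0)//= ler_pdivrMr// ler_wpM2l.
Qed.

Lemma sin_itv_ge0 x : 0 <= x <= l -> 0 <= sin (pi * x / l).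
Proof. by move=> /arg_itv /sin_ge0_pi. Qed.

Lemma sine_der x : is_derive x 1 (fun x => sin (pi * x / l)) (cos (pi * x / l) * (pi / l)).
Proof. by apply: der_eq; rewrite /GRing.scale/=; ring. Qed.

Lemma sine_scale_der k x : is_derive x 1 (fun x => sin (k * (pi * x / l)))
  (cos (k * (pi * x / l)) * (k * (pi / l))).
Proof. by apply: der_eq; rewrite /GRing.scale/=; ring. Qed.

(** [g] need not vanish at the ends, so g / sin may be unbounded; sin is replaced by max(sin, s0) in
    the denominator. Then q is uniformly close to g * th with th = sin / max(sin, s0) in [0, 1], and
    th = 1 except near the ends. There q cannot follow g, since q is 0 at the ends: a uniform bound
    must lose the size [d] of the boundary values, whereas the error weighted by the sine stays
    small. *)
Lemma sine_approx g e : {within `[0, l], continuous g} -> 0 < e ->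
  exists p : {poly R}, let q x := sin (pi * x / l) * p.[cos (pi * x / l)] in
  [/\ forall x, 0 <= x <= l -> sin (pi * x / l) * `|g x - q x| <= e,
      forall d x, 0 <= d -> g 0 <= d -> g l <= d -> 0 <= x <= l -> g x <= q x + d + e &
      forall d x, 0 <= d -> - d <= g 0 -> - d <= g l -> 0 <= x <= l ->
        q x - d - e <= g x].
Proof.
move=> gc e0; have pi0 := pi_gt0 R; have l0' := l0.
have [B B0 gB] := within_continuous_bounded _ _ _ (ltW l0) gc.
have cg := clamp_continuous _ _ _ (ltW l0) gc.
have gE x : 0 <= x <= l -> g (clamp 0 l x) = g x by move=> xl; rewrite clampE.
have near_end y : 0 <= y <= l -> exists2 eta, 0 < eta & forall x, 0 <= x <= l ->
    `|x - y| < eta -> `|g x - g y| <= e / 2.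
  move=> yl; have /cvgrPdist_le /(_ (e / 2) ltac:(lra)) [eta /= eta0 H] := cg y.
  exists eta => // x xl xy; have := H x; rewrite /= distrC xy => /(_ isT).
  by rewrite !gE// distrC.
have [eta0 eta00 H0] : exists2 eta, 0 < eta & forall x, 0 <= x <= l ->
    `|x - 0| < eta -> `|g x - g 0| <= e / 2.
  by apply: near_end; rewrite lexx ltW.
have [eta1 eta10 H1] : exists2 eta, 0 < eta & forall x, 0 <= x <= l ->
    `|x - l| < eta -> `|g x - g l| <= e / 2.
  by apply: near_end; rewrite lexx ltW.
pose eta := Num.min (l / 3) (Num.min eta0 eta1).
have eta_gt0 : 0 < eta by rewrite !lt_min eta00 eta10 !andbT; lra.
have etal : eta <= l / 3 by rewrite ge_min lexx.
have etae0 : eta <= eta0 by rewrite !ge_min lexx orbT.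
have etae1 : eta <= eta1 by rewrite !ge_min lexx !orbT.
have [s1 s10 s1P] : exists2 s1, 0 < s1 &
    forall x, eta <= x <= l - eta -> s1 <= sin (pi * x / l).
  have sc : {within `[eta, l - eta], continuous (fun x => sin (pi * x / l))}.
    by apply: continuous_subspaceT => x; exact: der_continuous (sine_der x).
  have [|z zi zmin] := @EVT_min R _ _ _ _ sc; first lra.
  exists (sin (pi * z / l)); last by move=> x xi; apply: zmin.
  by apply: sin_itv_gt0; move: zi; rewrite in_itv/=; lra.
(* Below [s1], the cutoff is inactive on [eta, l - eta]; below e / (B + e), the weighted error where
   it is active is at most sin * (B + e) <= e. *)
pose s0 := Num.min s1 (e / (B + e)).
have s00 : 0 < s0 by rewrite lt_min s10 divr_gt0//; lra.
have s0e : s0 <= e / (B + e) by rewrite ge_min lexx orbT.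
have s0s1 : s0 <= s1 by rewrite ge_min lexx.
pose f y := g (clamp 0 l (l * y / pi)) / Num.max (sin y) s0.
have f_cont : continuous f.
  have c1 : continuous (fun y : R => l * y / pi).
    by move=> y; apply: cvgM; [apply: cvgMr; exact: cvg_id|exact: cvg_cst].
  have c2 : continuous (fun y : R => Num.max (sin y) s0).
    move=> y; apply: (@continuous_max _ _ sin (fun=> s0)); last exact: cvg_cst.
    exact: continuous_sin.
  move=> y; apply: cvgM; first exact: (continuous_funcomp _ _ c1 cg).
  apply: cvgV; last exact: c2.
  by rewrite gt_eqF// lt_max s00 orbT.
have [p pP] := @weierstrass_cos R f (e / 2) (continuous_subspaceT f_cont) ltac:(lra).
exists p => q.
have key x : 0 <= x <= l -> exists th, [/\ 0 <= th <= 1, `|g x * th - q x| <= e / 2 &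
    th = 1 \/ sin (pi * x / l) <= e / (B + e) /\
      (`|g x - g 0| <= e / 2 \/ `|g x - g l| <= e / 2)].
  move=> xl; have sx0 := sin_itv_ge0 x xl.
  set s := sin (pi * x / l) in sx0 *.
  have m0 : 0 < Num.max s s0 by rewrite lt_max s00 orbT.
  exists (s / Num.max s s0); split.
  - by rewrite divr_ge0 ?(ltW m0)//= ler_pdivrMr// mul1r le_max lexx.
  - have := pP (pi * x / l); rewrite /f /q -/s.
    have -> : l * (pi * x / l) / pi = x.
      by move: (pi : R) pi0 => ppi ppi0; field; rewrite !gt_eqF.
    rewrite gE// => H.
    have -> : g x * (s / Num.max s s0) - s * p.[cos (pi * x / l)] =
      s * (g x / Num.max s s0 - p.[cos (pi * x / l)]) by ring.
    rewrite normrM (ger0_norm sx0) -[leRHS]mul1r ler_pM ?sin_le1//.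
    exact/H/arg_itv.
  - have [ss0|ss0] := leP s0 s; first by left; rewrite divff// gt_eqF// (lt_le_trans s00).
    right; split; first by rewrite (le_trans (ltW ss0)).
    have [xe|xe] := ltP x eta; first by left; apply: H0 => //; rewrite subr0 ger0_norm; lra.
    have [xe'|xe'] := ltP (l - eta) x.
      by right; apply: H1 => //; rewrite ler0_norm; lra.
    by have := s1P x; rewrite xe xe' -/s => /(_ isT); lra.
split.
- move=> x xl; have sx0 := sin_itv_ge0 x xl; have sx1 := sin_le1 (pi * x / l).
  have [th [/andP[th0 th1] H [E|[se _]]]] := key x xl.
    move: H; rewrite E mulr1 => H; apply: le_trans (_ : 1 * (e / 2) <= e); last lra.
    by apply: ler_pM.
  have H2 : `|g x - q x| <= B + e.
    have -> : g x - q x = g x * (1 - th) + (g x * th - q x) by ring.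
    apply: le_trans (ler_normD _ _) _; apply: lerD; last lra.
    rewrite normrM -[leRHS]mulr1; apply: ler_pM => //; first exact: gB.
    by rewrite ger0_norm; lra.
  apply: le_trans (_ : e / (B + e) * (B + e) <= e); first exact: ler_pM.
  by rewrite divfK// gt_eqF//; lra.
- move=> d x d0 g0 gl xl.
  have [th [/andP[th0 th1] H [E|[_ gend]]]] := key x xl.
    by move: H; rewrite E mulr1 ler_norml; lra.
  have gx : g x <= d + e / 2 by case: gend; rewrite ler_norml; lra.
  have : g x * (1 - th) <= d + e / 2.
    have [gx0|gx0] := leP 0 (g x); last nra.
    by apply: le_trans gx; rewrite ler_piMr//; lra.
  by move: H; rewrite ler_norml; lra.
- move=> d x d0 g0 gl xl.
  have [th [/andP[th0 th1] H [E|[_ gend]]]] := key x xl.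
    by move: H; rewrite E mulr1 ler_norml; lra.
  have gx : - (d + e / 2) <= g x by case: gend; rewrite ler_norml; lra.
  have : - (d + e / 2) <= g x * (1 - th).
    have [gx0|gx0] := leP (g x) 0; last nra.
    rewrite lerNl -mulNr; apply: (@le_trans _ _ (- g x)); last lra.
    by rewrite ler_piMr//; lra.
  by move: H; rewrite ler_norml; lra.
Qed.

(** The first Fourier sine coefficient without its normalising factor 2 / l. *)
Definition moment (u : R -> R) : R :=
  (\int[@lebesgue_measure R]_(s in `[0, l]) (u s * sin (pi * s / l)))%R.

Lemma integrable_itvcc (u : R -> R) (a b : R) : {within `[a, b], continuous u} ->
  (@lebesgue_measure R).-integrable `[a, b] (EFin \o u).
Proof.
by move=> uc; apply: continuous_compact_integrable uc; exact: segment_compact.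
Qed.

Lemma sine_continuousM u : {within `[0, l], continuous u} ->
  {within `[0, l], continuous (fun s => u s * sin (pi * s / l))}.
Proof.
move=> uc x; apply: cvgM; first exact: uc.
move: x; apply: continuous_subspaceT => x; exact: der_continuous (sine_der x).
Qed.

Lemma momentD u v : {within `[0, l], continuous u} -> {within `[0, l], continuous v} ->
  moment (fun x => u x + v x) = moment u + moment v.
Proof.
move=> uc vc; rewrite /moment -RintegralD//.
- by apply: eq_Rintegral => x _; rewrite mulrDl.
- by apply: integrable_itvcc; exact: sine_continuousM.
- by apply: integrable_itvcc; exact: sine_continuousM.
Qed.

Lemma momentZ k u : {within `[0, l], continuous u} ->
  moment (fun x => k * u x) = k * moment u.
Proof.
move=> uc; rewrite /moment -RintegralZl//.
- by apply: eq_Rintegral => x _; rewrite mulrA.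
- by apply: integrable_itvcc; exact: sine_continuousM.
Qed.

(** The comparison is asked only after weighting by the sine, the form in which [sine_approx] gives
    a small error for functions not vanishing at the ends. *)
Lemma moment_le e u v : {within `[0, l], continuous u} -> {within `[0, l], continuous v} ->
  (forall x, 0 <= x <= l ->
    u x * sin (pi * x / l) <= v x * sin (pi * x / l) + e) ->
  moment u <= moment v + e * l.
Proof.
move=> uc vc uv.
have -> : e * l = (\int[@lebesgue_measure R]_(s in `[0, l]) e)%R.
  by rewrite Rintegral_cst//= lebesgue_measure_itv/= lte_fin l0 oppr0 adde0.
have ic : (@lebesgue_measure R).-integrable `[0, l] (EFin \o (fun=> e)).
  by apply: integrable_itvcc; apply: continuous_subspaceT => x; exact: cvg_cst.
have iu := integrable_itvcc _ _ _ (sine_continuousM _ uc).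
have iv := integrable_itvcc _ _ _ (sine_continuousM _ vc).
rewrite /moment -RintegralD//; apply: le_Rintegral => //.
- apply: integrable_itvcc => x; apply: cvgD; last exact: cvg_cst.
  exact: sine_continuousM.
Qed.

Lemma Rintegral_der (f F : R -> R) (a b : R) : a < b -> continuous f ->
  (forall x, is_derive x 1 F (f x)) ->
  (\int[@lebesgue_measure R]_(x in `[a, b]) f x)%R = F b - F a.
Proof.
move=> ab fc Fd; rewrite /Rintegral (@continuous_FTC2 _ f F)//.
- exact: continuous_subspaceT.
- split.
  + by move=> x _; apply: ex_derive.
  + apply: cvg_at_right_filter; exact: der_continuous (Fd a).
  + apply: cvg_at_left_filter; exact: der_continuous (Fd b).
- by move=> x _; exact: der1E.
Qed.

Lemma sin_natpi (k : nat) : sin (k%:R * pi) = 0 :> R.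
Proof.
elim: k => [|k IH]; first by rewrite mul0r sin0.
by rewrite -natr1 mulrDl mul1r sinDpi IH oppr0.
Qed.

Lemma moment_sin1 : moment (fun x => sin (pi * x / l)) = l / 2.
Proof.
have pi0 := pi_gt0 R.
have Fd (x : R) : is_derive x 1 (fun x => x / 2 - l / (4 * pi) * sin (2 * (pi * x / l)))
    (sin (pi * x / l) * sin (pi * x / l)).
  apply: der_eq; rewrite /GRing.scale/=.
  have -> : 2 * (pi * x / l) = (pi * x / l) *+ 2 by rewrite mulr_natl.
  rewrite cos_mulr2n -[_ ^+ 2 *+ 2]mulr_natr; move: (cos2Dsin2 (pi * x / l)) => E.
  have -> : (cos (pi * x / l)) ^+ 2 = 1 - (sin (pi * x / l)) ^+ 2 by rewrite -E addrK.
  by move: (pi : R) pi0 => ppi ppi0; field; rewrite !gt_eqF.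
rewrite /moment (Rintegral_der _ _ _ _ l0 _ Fd).
  have -> : 2 * (pi * l / l) = 2%:R * pi by rewrite mulfK ?gt_eqF.
  by rewrite sin_natpi !(mulr0, mul0r) sin0; ring.
by move=> x; apply: cvgM; exact: der_continuous (sine_der x).
Qed.

(** Orthogonality to the first mode through the product-to-sum formula. The antiderivative has the
    frequencies k + 1 and k + 3 as denominators, both nonzero; this is what fails for the first mode
    itself. *)
Lemma moment_sin (k : nat) : moment (fun x => sin (k.+2%:R * (pi * x / l))) = 0.
Proof.
have pi0 := pi_gt0 R.
have k1 : (k.+1%:R : R) != 0 by rewrite pnatr_eq0.
have k3 : (k.+3%:R : R) != 0 by rewrite pnatr_eq0.
have Fd (x : R) : is_derive x 1 (fun x => l / (2 * pi) *
    (sin (k.+1%:R * (pi * x / l)) / k.+1%:R - sin (k.+3%:R * (pi * x / l)) / k.+3%:R))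
    (sin (k.+2%:R * (pi * x / l)) * sin (pi * x / l)).
  apply: der_eq; rewrite /GRing.scale/=.
  have E1 : k.+1%:R * (pi * x / l) = k.+2%:R * (pi * x / l) - pi * x / l.
    by rewrite -[k.+2%:R]natr1; ring.
  have E3 : k.+3%:R * (pi * x / l) = k.+2%:R * (pi * x / l) + pi * x / l.
    by rewrite -[k.+3%:R]natr1; ring.
  rewrite E1 E3 cosB cosD; move: (pi : R) pi0 => ppi ppi0; field.
  by rewrite !gt_eqF ?k1 ?k3//.
rewrite /moment (Rintegral_der _ _ _ _ l0 _ Fd).
  have -> : pi * l / l = pi :> R by rewrite mulfK// gt_eqF.
  by rewrite !sin_natpi !(mulr0, mul0r) sin0; ring.
move=> x; apply: cvgM; last exact: der_continuous (sine_der x).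
exact: der_continuous (sine_scale_der _ x).
Qed.

End SineApproximation.

(** * Explicit evolution of finite sine sums at the critical value *)

Section SineEvolution.
Context {R : realType} (l : R) (l0 : 0 < l).
Implicit Types (u v g : R -> R) (x t b e d : R).

(** Collects what is used of the solution with initial value [g] and zero boundary values: it tends
    to its first mode, of amplitude [b], and its moment is constant in time. The amplitude is
    existential, so that the property passes to linear combinations and no coefficients need to be
    computed. *)
Definition sine_evolution (g : R -> R) : Prop :=
  exists P b C, [/\ parabolic ((pi / l) ^+ 2) 0 0 l P (fun _ _ => 0),
    P 0 = g, forall t, P t 0 = 0 /\ P t l = 0,
    0 <= C /\ forall t x, 0 <= t ->
      `|P t x - b * sin (pi * x / l)| <= C * expR (- (pi / l) ^+ 2 * t) &
    forall t, 0 <= t -> moment l (P t) = b * (l / 2)].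

Lemma sine_evolution0 : sine_evolution (fun=> 0).
Proof.
exists (fun _ _ => 0), 0, 0; split => //.
- split; first by apply: continuous_subspaceT => x; exact: cvg_cst.
  exists (fun _ _ => 0), (fun _ _ => 0), (fun _ _ => 0) => t x _ _.
  by split; [exact: der_cst|exact: der_cst|exact: der_cst|ring].
- by split => // t x _; rewrite !mul0r subrr normr0.
- move=> t _; rewrite /moment mul0r.
  under eq_Rintegral do rewrite mul0r.
  by rewrite Rintegral_cst// mul0r.
Qed.

Lemma sine_evolutionD g h : sine_evolution g -> sine_evolution h ->
  sine_evolution (fun x => g x + h x).
Proof.
move=> [P [b [C [PP P0 Pb [C0 PC] Pm]]]] [Q [b' [C' [QP Q0 Qb [C'0 QC] Qm]]]].
exists (fun t x => P t x + Q t x), (b + b'), (C + C'); split.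
- by apply: parabolic_ext (parabolicD PP QP) => // ? ?; rewrite addr0.
- by rewrite P0 Q0.
- by move=> t; have [-> ->] := Pb t; have [-> ->] := Qb t; rewrite !addr0.
- split; first exact: addr_ge0.
  move=> t x t0; rewrite mulrDl opprD addrACA.
  by apply: le_trans (ler_normD _ _) _; rewrite [leRHS]mulrDl lerD ?PC ?QC.
- move=> t t0; rewrite momentD ?Pm ?Qm ?mulrDl//.
  + exact: strip_section_continuous t0 PP.1.
  + exact: strip_section_continuous t0 QP.1.
Qed.

Lemma sine_evolutionZ k g : sine_evolution g -> sine_evolution (fun x => k * g x).
Proof.
move=> [P [b [C [PP P0 Pb [C0 PC] Pm]]]].
exists (fun t x => k * P t x), (k * b), (`|k| * C); split.
- by apply: parabolic_ext (parabolicZ k PP) => // ? ?; rewrite mulr0.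
- by rewrite P0.
- by move=> t; have [-> ->] := Pb t; rewrite mulr0.
- split; first exact: mulr_ge0.
  by move=> t x t0; rewrite -(mulrA k b) -mulrBr normrM -[leRHS]mulrA ler_wpM2l// PC.
- move=> t t0; rewrite momentZ ?Pm ?mulrA//.
  exact: strip_section_continuous t0 PP.1.
Qed.

Lemma sine_evolution_mode (k : nat) :
  sine_evolution (fun x => sin (k.+1%:R * (pi * x / l))).
Proof.
have pi0 := pi_gt0 R.
pose Phi := (pi / l) ^+ 2; have Phi0 : 0 < Phi by rewrite exprn_gt0 ?divr_gt0.
pose lam := Phi * (k.+1%:R ^+ 2 - 1).
(* Mode k + 1 decays at rate Phi ((k+1)^2 - 1), which is 0 for k = 0 and at least Phi otherwise.
   Hence the first mode is stationary with amplitude 1 and error constant 0, and any higher one has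
   amplitude 0 and error constant 1. *)
exists (fun t x => expR (- lam * t) * sin (k.+1%:R * (pi * x / l))),
  (k == 0%N)%:R, (k != 0%N)%:R; split.
- have ed (t : R) : is_derive t 1 (fun t => expR (- lam * t)) (- lam * expR (- lam * t)).
    by apply: der_eq; rewrite /GRing.scale/=; ring.
  apply: parabolic_ext; last first.
    apply: (@parabolicM _ Phi 0 0 l (fun t => expR (- lam * t))
      (fun t => - lam * expR (- lam * t)) (fun x => sin (k.+1%:R * (pi * x / l)))
      (fun x => cos (k.+1%:R * (pi * x / l)) * (k.+1%:R * (pi / l)))
      (fun x => - sin (k.+1%:R * (pi * x / l)) * (k.+1%:R * (pi / l)) ^+ 2)).
    + by apply: continuous_subspaceT => t; exact: der_continuous (ed t).
    + by move=> x; apply: der_eq; rewrite /GRing.scale/=; ring.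
    + by move=> x; apply: der_eq; rewrite /GRing.scale/=; ring.
  + by move=> t x /=; rewrite /lam /Phi; ring.
  + by [].
- by apply/funext => x; rewrite mulr0 expR0 mul1r.
- move=> t; rewrite mulr0 mul0r mulr0 sin0 mulr0; split => //.
  by rewrite mulfK ?gt_eqF// sin_natpi mulr0.
- split; first by case: eqP.
  move=> t x t0; case: k @lam => [|k] lam /=.
    rewrite /lam expr1n subrr mulr0 oppr0 mul0r expR0 !mul1r subrr normr0.
    by rewrite mul0r.
  rewrite mul0r subr0 mul1r normrM ger0_norm ?expR_ge0// -[leRHS]mulr1.
  apply: ler_pM => //.
    rewrite ler_expR; apply: ler_wpM2r => //; rewrite lerN2 /lam ler_peMr ?ltW//.
    by have := ler0n R k; rewrite -natr1 -natr1 => k0; nra.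
  by rewrite ler_norml sin_geN1 sin_le1.
- move=> t t0; rewrite momentZ; last first.
    by apply: continuous_subspaceT => x; exact: der_continuous (sine_scale_der l _ x).
  case: k @lam => [|k] lam /=; last by rewrite moment_sin// mulr0 mul0r.
  under eq_fun do rewrite mul1r.
  by rewrite moment_sin1// /lam expr1n subrr mulr0 oppr0 mul0r expR0.
Qed.

(** Induction in Horner form with the sine frequency left free: multiplying sin(k y) by cos y gives
    half the sum of sin((k-1) y) and sin((k+1) y). Frequency 0 gives the zero function and is
    treated apart, having no predecessor. *)
Lemma sine_evolution_poly (p : {poly R}) :
  sine_evolution (fun x => sin (pi * x / l) * p.[cos (pi * x / l)]).
Proof.
suff H (k : nat) : sine_evolution
    (fun x => sin (k%:R * (pi * x / l)) * p.[cos (pi * x / l)]).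
  by have := H 1%N; under eq_fun do rewrite mul1r.
elim/poly_ind: p k => [|p c IH] k.
  under eq_fun do rewrite horner0 mulr0; exact: sine_evolution0.
case: k => [|k].
  under eq_fun do rewrite mul0r sin0 mul0r; exact: sine_evolution0.
have := sine_evolutionD _ _ (sine_evolutionD _ _ (sine_evolutionZ (2^-1) _ (IH k))
  (sine_evolutionZ (2^-1) _ (IH k.+2))) (sine_evolutionZ c _ (sine_evolution_mode k)).
congr sine_evolution; apply/funext => x.
rewrite hornerD hornerM hornerX hornerC.
have -> : k%:R * (pi * x / l) = k.+1%:R * (pi * x / l) - pi * x / l.
  by rewrite -natr1; ring.
have -> : k.+2%:R * (pi * x / l) = k.+1%:R * (pi * x / l) + pi * x / l.
  by rewrite -[k.+2%:R]natr1; ring.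
by rewrite sinB sinD; field.
Qed.

End SineEvolution.

(** * Barrier and moment estimates in the critical case *)

Section HalfLine.
Context {R : realType}.
Implicit Types (f F : R -> R) (t : R).

Lemma halfline_continuous_norm f : {within `[0, +oo[, continuous f} ->
  continuous (fun t => f `|t|).
Proof.
move=> fc; suff : {within setT, continuous (fun t => f `|t|)}.
  by rewrite -continuous_subspace_setT.
apply: within_continuous_comp fc; first by move=> t _; rewrite /= in_itv/= andbT.
by apply: continuous_subspaceT => t; apply: cvg_norm; exact: cvg_id.
Qed.

Lemma halfline_antiderivative f : {within `[0, +oo[, continuous f} ->
  exists F, {within `[0, +oo[, continuous F} /\
    forall t, 0 < t -> is_derive t 1 F (f t).
Proof.
move=> /halfline_continuous_norm fc.
(* Integrating the even extension from -1 makes 0 an interior point, so continuity of [F] at 0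
   follows from differentiability there. *)
pose F t := (\int[@lebesgue_measure R]_(s in `[(-1)%R, t]) f `|s|)%R.
have Fd t : -1 < t -> is_derive t 1 F (f `|t|).
  move=> t1; have t2 : t < t + 1 by lra.
  have ifn : (@lebesgue_measure R).-integrable [set` Interval (BLeft (-1)) (BRight (t + 1))]
      (EFin \o (fun s => f `|s|)).
    by apply: integrable_itvcc; exact: continuous_subspaceT.
  have [|dF FE] := continuous_FTC1 t2 ifn _ (fc t).
    by rewrite /= lte_fin.
  by apply: DeriveDef => //; rewrite -derive1E.
exists F; split.
  apply: derivable_within_continuous => t; rewrite in_itv/= andbT => t0.
  by apply: ex_derive; apply: Fd; lra.
move=> t t0; rewrite -{2}(gtr0_norm t0); apply: Fd; lra.
Qed.

Lemma halfline_nondecreasing f F : {within `[0, +oo[, continuous F} ->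
  (forall t, 0 < t -> is_derive t 1 F (f t)) -> (forall t, 0 < t -> 0 <= f t) ->
  forall s t, 0 <= s <= t -> F s <= F t.
Proof.
move=> Fc Fd f0 s t /andP[s0 st].
have [->//|st'] := eqVneq s t.
have {st st'}st : s < t by rewrite lt_neqAle st'.
have [c||c] := @MVT R F f s t st.
- by rewrite in_itv/= => /andP[sc _]; apply: Fd; exact: le_lt_trans sc.
- apply: continuous_subspaceW Fc => x /=; rewrite !in_itv/= andbT => /andP[sx _].
  exact: le_trans sx.
rewrite in_itv/= => /andP[sc _] E; rewrite -subr_ge0 E.
by apply: mulr_ge0; [apply: f0; exact: le_lt_trans sc|rewrite subr_ge0 ltW].
Qed.

End HalfLine.

Section CriticalCase.
Context {R : realType} (l : R) (l0 : 0 < l).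
Implicit Types (u v g : R -> R) (x t b e d : R).
Local Notation Phi := ((pi / l) ^+ 2).

Lemma parabolic_shift c T a b (u r : R -> R -> R) : parabolic c T a b u r ->
  parabolic c 0 a b (fun t => u (T + t)) (fun t => r (T + t)).
Proof.
move=> [uc [ut [ux [uxx uH]]]]; split.
  apply: (@within_continuous_comp _ _ _ (strip 0 a b) (strip T a b)
    (fun z : R * R => (T + z.1, z.2)) (fun z => u z.1 z.2)) uc.
    by move=> [t x] [/= t0 xab]; split => //=; lra.
  apply: continuous_subspaceT => z.
  have c1 : (fun z : R * R => T + z.1) @ z --> T + z.1.
    by apply: cvgD; [exact: cvg_cst|exact: cvg_fst].
  exact: (@cvg_pair _ _ _ _ _ _ _ _ _ (fun z : R * R => T + z.1) snd c1 cvg_snd).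
exists (fun t => ut (T + t)), (fun t => ux (T + t)), (fun t => uxx (T + t)) => t x t0 xab.
have [|u1 u2 u3 u4] := uH (T + t) x _ xab; first lra.
split => //; apply: (@der_eq _ _ _ (ut (T + t) x * (0 + 1))); last ring.
exact: (der_comp u1 (derD (der_cst T t) (der_id t))).
Qed.

(** For c = (pi/l)^2 the source is e' times the sine: a growing coefficient of the null mode
    produces a nonnegative source at no other cost. *)
Lemma parabolic_sine c T (e e' : R -> R) : {within `[T, +oo[, continuous e} ->
  (forall t : R, T < t -> is_derive t 1 e (e' t)) ->
  parabolic c T 0 l (fun t x => e t * sin (pi * x / l))
    (fun t x => (e' t - e t * (c - Phi)) * sin (pi * x / l)).
Proof.
move=> ec ed; apply: parabolic_ext; last first.
  apply: (@parabolicM _ c T 0 l e e' (fun x => sin (pi * x / l))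
    (fun x => cos (pi * x / l) * (pi / l)) (fun x => - Phi * sin (pi * x / l)) ec ed).
  - exact: sine_der.
  - by move=> x; apply: der_eq; rewrite /GRing.scale/=; ring.
- by move=> t x /=; ring.
- by [].
Qed.

(* Comparison with the solution [al * t * S + q] having the constant boundary
   values [m0] and [m1]. *)
Lemma moment_growth (u : R -> R -> R) m0 m1 h :
  parabolic Phi 0 0 l u (fun _ _ => 0) -> 0 <= h ->
  (forall t, 0 <= t <= h -> u t 0 <= m0 /\ u t l <= m1) ->
  moment l (u h) <= moment l (u 0) + pi / l * h * (m0 + m1).
Proof.
move=> uP h0 um; have l0' := l0; have pi0 := pi_gt0 R.
(* [A] is fixed by q(l) = - (A l + m0) = m1. Then q'' + Phi q = - 2 A (pi/l) sin(pi x / l) is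
   resonant, and al = - 2 A pi / l is the growth rate that balances it. *)
pose A := - (m0 + m1) / l; pose al := 2 * pi * (m0 + m1) / l ^+ 2.
pose q x := (A * x + m0) * cos (pi * x / l).
have qd (x : R) : is_derive x 1 q
    (A * cos (pi * x / l) - (A * x + m0) * sin (pi * x / l) * (pi / l)).
  by rewrite /q; apply: der_eq; rewrite /GRing.scale/=; ring.
have q'd (x : R) : is_derive x 1
    (fun x => A * cos (pi * x / l) - (A * x + m0) * sin (pi * x / l) * (pi / l))
    (- (2 * A * (pi / l)) * sin (pi * x / l) - Phi * q x).
  by rewrite /q; apply: der_eq; rewrite /GRing.scale/=; ring.
have q0 : q 0 = m0 by rewrite /q !(mulr0, mul0r) cos0; ring.
have ql : q l = m1.
  by rewrite /q mulfK ?gt_eqF// cospi /A mulfVK ?gt_eqF//; ring.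
have cstc (T : R) : {within `[T, +oo[, continuous (fun=> 1 : R)}.
  by apply: continuous_subspaceT => t; exact: cvg_cst.
have ed (t : R) : is_derive t 1 (fun t => al * t) al.
  by apply: der_eq; rewrite /GRing.scale/=; ring.
have qP := @parabolicM R Phi 0 0 l (fun=> 1) (fun=> 0) q _ _ (cstc 0)
  (fun t _ => der_cst 1 t) qd q'd.
have zP := parabolicD (@parabolic_sine Phi 0 (fun t => al * t) (fun=> al)
  (continuous_subspaceT (fun t => der_continuous (ed t))) (fun t _ => ed t)) qP.
have {zP qP}zP : parabolic Phi 0 0 l (fun t x => al * t * sin (pi * x / l) + q x)
    (fun _ _ => 0).
  apply: parabolic_ext zP; first by move=> t x /=; rewrite mul1r.
  by move=> t x /=; rewrite /al /A; field; rewrite gt_eqF.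
have uc t : 0 <= t -> {within `[0, l], continuous (u t)}.
  by move=> t0; exact: strip_section_continuous t0 uP.1.
have qc : {within `[0, l], continuous q}.
  by apply: continuous_subspaceT => x; exact: der_continuous (qd x).
have Sc : {within `[0, l], continuous (fun x => sin (pi * x / l))}.
  by apply: continuous_subspaceT => x; exact: der_continuous (sine_der l x).
(* Collects two errors: [e * l] from approximating the initial difference in moment, and
   [e * expR (Phi * h) * l] from the comparison at time [h]. *)
pose K := l + expR (Phi * h) * l.
have K0 : 0 < K by rewrite ltr_wpDr// mulr_ge0 ?expR_ge0 ?ltW.
suff H e : 0 < e -> moment l (u h) <= moment l (u 0) + pi / l * h * (m0 + m1) + e * K.
  apply/ler_addgt0Pr => e e0; have := H (e / K) (divr_gt0 e0 K0).
  by rewrite divfK// gt_eqF.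
(* This difference is nonpositive at both ends, so the one-sided estimate of [sine_approx] holds
   with d = 0. The evolution of the approximant keeps its moment, which brings the estimate at time
   [h] back to time 0. *)
move=> e0; pose g x := u 0 x + (-1) * q x.
have mqc : {within `[0, l], continuous (fun x => (-1) * q x)}.
  by move=> x; apply: cvgMr; exact: qc.
have gc : {within `[0, l], continuous g}.
  by move=> x; apply: cvgD; [exact: uc|exact: mqc].
have [p /= [p1 p2 _]] := sine_approx l l0 g e gc e0.
have [u00 u0l] : u 0 0 <= m0 /\ u 0 l <= m1 by apply: um; rewrite lexx.
have [P [b [C [PP P0 Pb _ Pm]]]] := sine_evolution_poly l l0 p.
have expd (t : R) : is_derive t 1 (fun t => e * expR (Phi * t)) (e * Phi * expR (Phi * t)).
  by apply: der_eq; rewrite /GRing.scale/=; ring.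
have vP := @parabolicM R Phi 0 0 l _ _ (fun=> 1) (fun=> 0) (fun=> 0)
  (continuous_subspaceT (fun t => der_continuous (expd t))) (fun t _ => expd t)
  (der_cst 1) (der_cst 0).
have bound x : 0 <= x <= l -> u h x <=
    al * h * sin (pi * x / l) + q x + P h x + e * expR (Phi * h).
  move=> xl.
  suff : u h x - (al * h * sin (pi * x / l) + q x) - P h x <= e * expR (Phi * h) * 1.
    by lra.
  apply: (parabolic_le _ _ _ _ _ _ _ _ h (parabolicB (parabolicB uP zP) PP) vP) => //.
  - by move=> t y _ _ /=; rewrite !subr0; lra.
  - move=> y yl; rewrite P0 !mulr0 mul0r add0r expR0 !mulr1.
    have := p2 0 y (lexx 0) _ _ yl; rewrite /g q0 ql; lra.
  - move=> t th; have [-> ->] := Pb t; have [u1 u2] := um t th.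
    have := mulr_ge0 (ltW e0) (expR_ge0 (Phi * t)) => Ee.
    rewrite !(mulr0, mul0r) sin0 mulfK ?gt_eqF// sinpi q0 ql; lra.
have Pc t : 0 <= t -> {within `[0, l], continuous (P t)}.
  by move=> t0; exact: strip_section_continuous t0 PP.1.
have Szc : {within `[0, l], continuous (fun x => al * h * sin (pi * x / l))}.
  by move=> x; apply: cvgMr; exact: Sc.
have Szqc : {within `[0, l], continuous (fun x => al * h * sin (pi * x / l) + q x)}.
  by move=> x; apply: cvgD; [exact: Szc|exact: qc].
have M1 : moment l (u h) <= moment l (fun x => al * h * sin (pi * x / l) + q x + P h x)
    + e * expR (Phi * h) * l.
  apply: moment_le => //; first exact: uc.
    by move=> x; apply: cvgD; [exact: Szqc|exact: Pc].
  move=> x xl; have s0 := sin_itv_ge0 l l0 x xl; have s1 := sin_le1 (pi * x / l).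
  have := mulr_ge0 (ltW e0) (expR_ge0 (Phi * h)) => Ee.
  apply: le_trans (ler_wpM2r s0 (bound x xl)) _.
  by rewrite mulrDl lerD2l ler_piMr.
have M2 : moment l (P 0) <= moment l g + e * l.
  apply: moment_le => //; first exact: Pc.
  move=> x xl; have s0 := sin_itv_ge0 l l0 x xl.
  have := p1 x xl; rewrite P0 distrC => /(le_trans _) => H.
  have : sin (pi * x / l) * (sin (pi * x / l) * p.[cos (pi * x / l)] - g x) <= e.
    by apply: H; apply: ler_wpM2l => //; exact: ler_norm.
  lra.
move: M1 M2; rewrite !momentD ?momentZ ?moment_sin1 ?Pm//; last 2 first.
- exact: uc.
- exact: Pc.
have -> : al * h * (l / 2) = pi / l * h * (m0 + m1) by rewrite /al; field; rewrite gt_eqF.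
rewrite /K; lra.
Qed.

(* The barrier is [E h + D S] with [S = sin (pi x / l)] and [h = 4 - 3 S^2 >= 1],
   for which [- h'' - Phi h - (Phi / 2) h = - (15 / 2) Phi S^2]: the deficit is
   made up by [D' = (15 / 2) Phi E], and [E' = - (Phi / 2) E + a] keeps [E]
   above the boundary values. *)
Lemma critical_bound (u : R -> R -> R) (mu0 mu1 mu0' mu1' a A : R -> R) e :
  parabolic Phi 0 0 l u (fun _ _ => 0) ->
  {within `[0, +oo[, continuous mu0} -> {within `[0, +oo[, continuous mu1} ->
  (forall t, 0 < t -> is_derive t 1 mu0 (mu0' t)) ->
  (forall t, 0 < t -> is_derive t 1 mu1 (mu1' t)) ->
  (forall t, 0 <= t -> u t 0 = mu0 t /\ u t l = mu1 t) ->
  {within `[0, +oo[, continuous a} -> {within `[0, +oo[, continuous A} ->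
  (forall t, 0 < t -> is_derive t 1 A (a t)) ->
  (forall t, 0 < t -> `|mu0' t| + Phi / 2 * `|mu0 t| <= a t /\
     `|mu1' t| + Phi / 2 * `|mu1 t| <= a t) ->
  (forall t, 0 <= t -> A t - A 0 <= e) ->
  (forall x, 0 <= x <= l -> `|u 0 x| <= e) ->
  forall t x, 0 <= t -> 0 <= x <= l -> `|u t x| <= 38 * e.
Proof.
move=> uP mu0c mu1c mu0d mu1d umu ac Ac Ad amu Ae u0e t1 x1 t10 x1l.
have l0' := l0; have pi0 := pi_gt0 R.
have Phi0 : 0 < Phi by rewrite exprn_gt0// divr_gt0.
pose k := Phi / 2; have k0 : 0 < k by rewrite /k; lra.
have zl : 0 <= (0 : R) <= l by rewrite lexx ltW.
have ll : 0 <= l <= l by rewrite lexx ltW.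
have a0 t : 0 < t -> 0 <= a t.
  move=> t0; have [+ _] := amu t t0; apply: le_trans.
  by rewrite addr_ge0// mulr_ge0// ltW.
have expd c t : is_derive t 1 (fun t => expR (c * t)) (c * expR (c * t)).
  by apply: der_eq; rewrite /GRing.scale/=; ring.
have expc c B : {within B, continuous (fun t : R => expR (c * t))}.
  by apply: continuous_subspaceT => t; exact: der_continuous (expd c t).
have eac : {within `[0, +oo[, continuous (fun t => expR (k * t) * a t)}.
  by move=> t; apply: cvgM; [exact: expc|exact: ac].
have [W [Wc Wd]] := halfline_antiderivative _ eac.
pose E t := expR (- k * t) * (e + (W t - W 0)).
have cst_c (c : R) (B : set R) : {within B, continuous (fun=> c)}.
  by apply: continuous_subspaceT => t; exact: cvg_cst.
have W0c : {within `[0, +oo[, continuous (fun t => e + (W t - W 0))}.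
  by move=> t; apply: cvgD; [exact: cst_c|apply: cvgB; [exact: Wc|exact: cst_c]].
have Ec : {within `[0, +oo[, continuous E}.
  by move=> t; apply: cvgM; [exact: expc|exact: W0c].
have EK t : expR (k * t) * E t = e + (W t - W 0).
  by rewrite /E mulrA -expRD mulNr subrr expR0 mul1r.
have Ed t : 0 < t -> is_derive t 1 E (- k * E t + a t).
  move=> t0; have := Wd t t0 => Wdt.
  apply: (der_eq _ (derM (expd (- k) t)
    (derD (der_cst e t) (derB Wdt (der_cst (W 0) t))))).
  have ee : expR (- k * t) * expR (k * t) = 1 by rewrite -expRD mulNr addNr expR0.
  by rewrite /E -[in RHS](mul1r (a t)) -ee; ring.
have Ege (mu mu' : R -> R) : {within `[0, +oo[, continuous mu} ->
    (forall t, 0 < t -> is_derive t 1 mu (mu' t)) ->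
    (forall t, 0 < t -> `|mu' t| + k * `|mu t| <= a t) -> `|mu 0| <= e ->
    forall t, 0 <= t -> mu t <= E t.
  move=> muc mud mua mu0e t t0.
  (* This is exp(k t) (E t - mu t). Its derivative exp(k t) (a - mu' - k mu) is nonnegative by the
     choice of [a], so [E] stays above [mu] once it starts above. *)
  pose psi t := e + (W t - W 0) - expR (k * t) * mu t.
  have psic : {within `[0, +oo[, continuous psi}.
    by move=> s; apply: cvgB; [exact: W0c|apply: cvgM; [exact: expc|exact: muc]].
  have psid (s : R) : 0 < s -> is_derive s 1 psi (expR (k * s) * (a s - (mu' s + k * mu s))).
    move=> s0; have := mud s s0 => muds; have := Wd s s0 => Wds.
    apply: (der_eq _ (derB (derD (der_cst e s) (derB Wds (der_cst (W 0) s)))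
      (derM (expd k s) muds))); ring.
  have : psi 0 <= psi t.
    apply: (halfline_nondecreasing _ _ psic psid) => [s s0|]; last by rewrite lexx.
    rewrite mulr_ge0 ?expR_ge0// subr_ge0 (le_trans _ (mua s s0))//.
    by rewrite lerD ?ler_norm// ler_pM2l// ler_norm.
  rewrite /psi subrr addr0 mulr0 expR0 mul1r -EK => H.
  have : 0 <= expR (k * t) * (E t - mu t).
    by rewrite mulrBr; move: mu0e; rewrite ler_norml; lra.
  by rewrite pmulr_rge0 ?expR_gt0// subr_ge0.
have EgeN (mu mu' : R -> R) : {within `[0, +oo[, continuous mu} ->
    (forall t, 0 < t -> is_derive t 1 mu (mu' t)) ->
    (forall t, 0 < t -> `|mu' t| + k * `|mu t| <= a t) -> `|mu 0| <= e ->
    forall t, 0 <= t -> `|mu t| <= E t.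
  move=> muc mud mua mu0e t t0; rewrite ler_norml lerNl.
  rewrite (Ege mu mu')// andbT.
  apply: (Ege (fun t => - mu t) (fun t => - mu' t)) => //.
  - by move=> s; apply: cvgN; exact: muc.
  - by move=> s s0; apply: derN; exact: mud.
  - by move=> s s0; rewrite !normrN; exact: mua.
  - by rewrite normrN.
have [u00 u0l] := umu 0 (lexx 0).
have Emu0 t : 0 <= t -> `|mu0 t| <= E t.
  apply: (EgeN mu0 mu0') => //; last by rewrite -u00; exact: u0e.
  by move=> s /amu[].
have Emu1 t : 0 <= t -> `|mu1 t| <= E t.
  apply: (EgeN mu1 mu1') => //; last by rewrite -u0l; exact: u0e.
  by move=> s /amu[].
have E0 t : 0 <= t -> 0 <= E t.
  by move=> t0; apply: le_trans (Emu0 t t0); exact: normr_ge0.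
(* From A' = a and E' = - k E + a it follows that D' = 15 k E, the required (15/2) Phi E; thus the
   integral of [E] is expressed by [A] and [E] and is bounded with them. *)
pose D t := 15 * (e + (A t - A 0) - E t).
have AEc : {within `[0, +oo[, continuous (fun t => e + (A t - A 0) - E t)}.
  move=> t; apply: cvgB; last exact: Ec.
  by apply: cvgD; [exact: cst_c|apply: cvgB; [exact: Ac|exact: cst_c]].
have Dc : {within `[0, +oo[, continuous D}.
  by move=> t; apply: cvgMr; exact: AEc.
have Dd t : 0 < t -> is_derive t 1 D (15 * k * E t).
  move=> t0; have := Ad t t0 => Adt; have := Ed t t0 => Edt.
  apply: (der_eq _ (derM (der_cst 15 t) (derB (derD (der_cst e t)
    (derB Adt (der_cst (A 0) t))) Edt))); ring.
have D00 : D 0 = 0 by rewrite /D /E !subrr mulr0 expR0; ring.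
have kE0 t : 0 <= t -> 0 <= 15 * k * E t.
  by move=> t0; apply: mulr_ge0; [lra|exact: E0].
have D0 t : 0 <= t -> 0 <= D t.
  move=> t0; rewrite -D00; apply: (halfline_nondecreasing _ _ Dc Dd).
    by move=> s s0; apply: kE0; exact: ltW.
  by rewrite lexx.
pose h x := 4 - 3 * sin (pi * x / l) ^+ 2.
have hd (x : R) : is_derive x 1 h
    (- 6 * (sin (pi * x / l) * cos (pi * x / l) * (pi / l))).
  by rewrite /h; apply: der_eq; rewrite /GRing.scale/=; ring.
have h'd (x : R) : is_derive x 1
    (fun x => - 6 * (sin (pi * x / l) * cos (pi * x / l) * (pi / l)))
    (- 6 * Phi * (1 - 2 * sin (pi * x / l) ^+ 2)).
  apply: der_eq; rewrite /GRing.scale/=.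
  have c2 : cos (pi * x / l) ^+ 2 = 1 - sin (pi * x / l) ^+ 2.
    by rewrite -(cos2Dsin2 (pi * x / l)) addrK.
  transitivity (- 6 * Phi * (cos (pi * x / l) ^+ 2 - sin (pi * x / l) ^+ 2)); first ring.
  by rewrite c2; ring.
have vP := parabolicD
  (@parabolicM R Phi 0 0 l E _ h _ _ Ec Ed hd h'd) (@parabolic_sine Phi 0 D _ Dc Dd).
have S01 x : 0 <= x <= l -> 0 <= sin (pi * x / l) <= 1.
  by move=> xl; rewrite sin_itv_ge0// sin_le1.
have h1 x : 0 <= x <= l -> 1 <= h x.
  by move=> /S01 /andP[s0 s1]; rewrite /h; nra.
apply: (@le_trans _ _ (E t1 * h x1 + D t1 * sin (pi * x1 / l))).
  apply: (parabolic_norm_le _ _ _ _ _ _ _ t1 uP vP t10) => //.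
  - move=> t x t0 /andP[x0 xl] /=; rewrite subrr mulr0 subr0.
    have xl' : 0 <= x <= l by rewrite !ltW.
    have /andP[s0 s1] := S01 x xl'.
    have -> : (- k * E t + a t) * h x - E t *
      (- 6 * Phi * (1 - 2 * sin (pi * x / l) ^+ 2) + Phi * h x) +
      15 * k * E t * sin (pi * x / l) =
      a t * h x + 15 * k * E t * (sin (pi * x / l) * (1 - sin (pi * x / l))).
      by rewrite /h /k; field; rewrite gt_eqF.
    rewrite addr_ge0//; apply: mulr_ge0.
    + exact: a0.
    + by have := h1 x xl'; lra.
    + by apply: kE0; exact: ltW.
    + by rewrite mulr_ge0// subr_ge0.
  - move=> x xl; rewrite D00 mul0r addr0 /E subrr addr0 mulr0 expR0 mul1r.
    apply: le_trans (u0e x xl) _; rewrite ler_peMr ?h1//.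
    by apply: le_trans (u0e x xl); exact: normr_ge0.
  - move=> t /andP[t0 _]; have [-> ->] := umu t t0.
    rewrite /h !(mulr0, mul0r) sin0 mulfK ?gt_eqF// sinpi expr0n/= !mulr0 !subr0 !addr0.
    have := E0 t t0; have := Emu0 t t0; have := Emu1 t t0; lra.
(* Nonnegativity of [D] gives E <= 2 e, and nonnegativity of [E] gives D <= 30 e; with h <= 4 the
   barrier is at most 8 e + 30 e. *)
have := Ae t1 t10; have := E0 t1 t10; have := D0 t1 t10; have /andP[s0 s1] := S01 x1 x1l.
rewrite {1}/D => D1 E1 A1.
have : D t1 * sin (pi * x1 / l) <= D t1 by rewrite ler_piMr//; exact: D0.
have : E t1 * h x1 <= E t1 * 4.
  by rewrite ler_wpM2l ?E0// /h; have := sqr_ge0 (sin (pi * x1 / l)); lra.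
rewrite /D; lra.
Qed.

End CriticalCase.

(** * Integrals over the half-line *)

Section HalfLineIntegral.
Context {R : realType}.
Implicit Types (f g F G : R -> R) (t : R).
Local Notation leb := (@lebesgue_measure R).

Lemma is_derive1_cvg f (x d : R) :
  (forall e, 0 < e -> exists2 del, 0 < del & forall h, h != 0 -> `|h| < del ->
    `|(f (x + h) - f x) / h - d| <= e) -> is_derive x 1 f d.
Proof.
move=> H.
have fd : (fun h => h^-1 *: ((f \o shift x) (h *: (1 : R)) - f x)) h @[h --> 0^'] --> d.
  apply/cvgrPdist_le => e /H[del del0 Hdel]; exists del => // h.
  rewrite /= sub0r normrN => hdel h0; have := Hdel h h0 hdel.
  by rewrite distrC /GRing.scale/= mulr1 (addrC h) [X in `|_ - X| <= _]mulrC.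
apply: DeriveDef; first by apply/cvg_ex; exists d.
exact: cvg_lim fd.
Qed.

(** For t > 0 the half-line is a neighbourhood of t, so increments smaller than t never leave it. *)
Lemma half_quotient_cvgP f (t d : R) : 0 < t ->
  (half_quotient f t s @[s --> within `[0, +oo[%classic t^'] --> d) <->
  is_derive t 1 f d.
Proof.
move=> t0; split => [H|fd].
  apply: is_derive1_cvg => e e0.
  move/cvgrPdist_le : H => /(_ e e0) [del /= del0 Hdel].
  exists (Num.min del t); first by rewrite lt_min del0.
  move=> h h0; rewrite lt_min => /andP[hdel ht].
  have := Hdel (t + h); rewrite /= opprD addNKr normrN => /(_ hdel).
  rewrite -subr_eq0 addrAC subrr add0r => /(_ h0).
  rewrite /half_quotient addrAC subrr add0r distrC; apply.
  by rewrite in_itv/= andbT; move: ht; rewrite ltr_norml; lra.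
apply/cvgrPdist_le => e e0.
have [del del0 H] := is_derive1P _ _ _ _ fd e e0.
exists del => // s /=; rewrite distrC => sdel st _.
have := H (s - t); rewrite subr_eq0 => /(_ st sdel).
by rewrite (addrC t) subrK distrC => /ltW.
Qed.

Lemma half_derive_is_derive f t : C1_half_line f -> 0 < t ->
  is_derive t 1 f (half_derive f t).
Proof.
by move=> [fc _] t0; apply/half_quotient_cvgP => //; apply: fc; exact: ltW.
Qed.

Lemma half_deriveE f t d : 0 < t -> is_derive t 1 f d -> half_derive f t = d.
Proof.
move=> t0 fd; have /(half_quotient_cvgP _ _ _ t0) H := fd.
have E : within `[0, +oo[%classic t^' = t^'.
  apply/seteqP; split => P; last by apply: cvg_within.
  move=> [del /= del0 H']; exists (Num.min del t); first by rewrite /= lt_min del0.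
  move=> s; rewrite /= lt_min => /andP[sdel st] st'; apply: H' => //=.
  by rewrite in_itv/= andbT; move: st; rewrite ltr_norml; lra.
rewrite E in H; rewrite /half_derive E.
exact: (cvg_lim (@Rhausdorff R) H).
Qed.

(** Provides continuity of the boundary data on the closed half-line, as the restriction of the
    solution to a side of the strip. *)
Lemma halfline_section (a b : R) (u : R -> R -> R) (x : R) (mu : R -> R) :
  {within strip 0 a b, continuous (fun z : R * R => u z.1 z.2)} -> a <= x <= b ->
  (forall t, 0 <= t -> u t x = mu t) -> {within `[0, +oo[, continuous mu}.
Proof.
move=> uc xab umu.
have : {within `[0, +oo[, continuous (u^~ x)}.
  apply: (@within_continuous_comp _ _ _ `[(0 : R), +oo[%classic (strip 0 a b)
    (fun t : R => (t, x)) (fun z : R * R => u z.1 z.2) _ _ uc).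
    by move=> t; rewrite /= in_itv/= andbT.
  apply: continuous_subspaceT => t.
  exact: (@cvg_pair _ _ _ _ _ _ _ _ _ id (fun=> x) cvg_id (cvg_cst x)).
by apply: subspace_eq_continuous => t; rewrite inE/= in_itv/= andbT => /umu.
Qed.

Lemma halfline_shift f T : 0 <= T -> {within `[0, +oo[, continuous f} ->
  {within `[0, +oo[, continuous (fun t => f (T + t))}.
Proof.
move=> T0; apply: within_continuous_comp.
  by move=> t; rewrite /= !in_itv/= !andbT => t0; exact: addr_ge0.
by apply: continuous_subspaceT => t; apply: cvgD; [exact: cvg_cst|exact: cvg_id].
Qed.

Lemma halfline_der_shift f F T : 0 <= T -> (forall t, 0 < t -> is_derive t 1 F (f t)) ->
  forall t, 0 < t -> is_derive t 1 (fun t => F (T + t)) (f (T + t)).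
Proof.
move=> T0 Fd t t0; have /Fd Ft : 0 < T + t by rewrite ltr_wpDl.
by apply: (der_eq _ (der_comp Ft (derD (der_cst T t) (der_id t)))); ring.
Qed.

Lemma halfline_right_cvg F : {within `[0, +oo[, continuous F} -> F x @[x --> 0^'+] --> F 0.
Proof. by move=> /continuous_within_itvcyP[]. Qed.

Lemma Rintegral_segment f F t : {within `[0, +oo[, continuous f} ->
  {within `[0, +oo[, continuous F} -> (forall t, 0 < t -> is_derive t 1 F (f t)) ->
  0 < t -> (\int[leb]_(x in `[(0 : R)%R, t]) (f x)%:E = (F t - F 0)%:E)%E.
Proof.
move=> fc Fc Fd t0; rewrite (@continuous_FTC2 _ f F) ?EFinB//.
- apply: continuous_subspaceW fc => x /=; rewrite !in_itv/= andbT.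
  by case/andP.
- split.
  + by move=> x; rewrite in_itv/= => /andP[x0 _]; apply: ex_derive; exact: Fd.
  + exact: halfline_right_cvg.
  + by apply: cvg_at_left_filter; exact: der_continuous (Fd t t0).
- by move=> x; rewrite in_itv/= => /andP[x0 _]; apply: der1E; exact: Fd.
Qed.

(** [F] is nondecreasing and bounded by F(0) plus the finite integral, so it tends to its
    supremum. *)
Lemma halfline_antiderivative_cvg f F : {within `[0, +oo[, continuous f} ->
  {within `[0, +oo[, continuous F} -> (forall t, 0 < t -> is_derive t 1 F (f t)) ->
  (forall t, 0 <= f t) ->
  (\int[leb]_(x in `[(0 : R)%R, +oo[) (f x)%:E < +oo)%E ->
  exists L : R, F t @[t --> +oo] --> L.
Proof.
move=> fc Fc Fd f0 foo.
have mf : measurable_fun `[(0 : R), +oo[ f.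
  exact: subspace_continuous_measurable_fun.
have Fle t : 0 <= t -> F t <= F 0 + fine (\int[leb]_(x in `[(0 : R)%R, +oo[) (f x)%:E)%E.
  rewrite le_eqVlt => /predU1P[<-|t0].
    by rewrite lerDl fine_ge0// integral_ge0// => x _; rewrite lee_fin.
  rewrite -lerBlDl -lee_fin -(Rintegral_segment _ _ _ fc Fc Fd t0) fineK; last first.
    by rewrite ge0_fin_numE// integral_ge0// => x _; rewrite lee_fin.
  apply: ge0_subset_integral => //=; first exact/measurable_EFinP.
  - by move=> x _; rewrite lee_fin.
  - by move=> x; rewrite /= !in_itv/= andbT => /andP[].
pose S := [set F t | t in `[(0 : R)%R, +oo[%classic].
have S0 : S !=set0 by exists (F 0); exists 0 => //; rewrite /= in_itv/= lexx.
have Sub : has_ubound S.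
  by exists (F 0 + fine (\int[leb]_(x in `[(0 : R)%R, +oo[) (f x)%:E)%E) => _ [t + <-];
    rewrite /= in_itv/= andbT => /Fle.
exists (sup S); apply/cvgyP => e e0.
have [_ [T + <-] HT] := sup_adherent e0 (conj S0 Sub).
rewrite /= in_itv/= andbT => T0; exists T => // t Tt.
have FT : F T <= F t.
  by apply: (halfline_nondecreasing _ _ Fc Fd) => //; rewrite T0.
have : F t <= sup S.
  apply: ub_le_sup => //; exists t => //.
  by rewrite /= in_itv/= andbT (le_trans T0).
by rewrite ltr_norml; lra.
Qed.

(* [f] is written as [(f + g) - g], a difference of nonnegative functions. *)
Lemma Rintegral_halfline f g F G (L L' : R) :
  {within `[0, +oo[, continuous f} -> {within `[0, +oo[, continuous g} ->
  {within `[0, +oo[, continuous F} -> {within `[0, +oo[, continuous G} ->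
  (forall t, 0 < t -> is_derive t 1 F (f t)) ->
  (forall t, 0 < t -> is_derive t 1 G (g t)) ->
  (forall t, `|f t| <= g t) ->
  F t @[t --> +oo] --> L -> G t @[t --> +oo] --> L' ->
  leb.-integrable `[(0 : R), +oo[ (EFin \o f) /\
  (\int[leb]_(t in `[0, +oo[) f t)%R = L - F 0.
Proof.
move=> fc gc Fc Gc Fd Gd fg FL GL.
have g0 t : 0 <= g t by apply: le_trans (fg t); exact: normr_ge0.
have fg0 t : 0 <= f t + g t.
  have := fg t; rewrite ler_norml; lra.
have fgc : {within `[0, +oo[, continuous (fun t => f t + g t)}.
  by move=> t; apply: cvgD; [exact: fc|exact: gc].
have FGc : {within `[0, +oo[, continuous (fun t => F t + G t)}.
  by move=> t; apply: cvgD; [exact: Fc|exact: Gc].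
have FGd t : 0 < t -> is_derive t 1 (fun t => F t + G t) (f t + g t).
  by move=> t0; apply: derD; [exact: Fd|exact: Gd].
have Ig : (\int[leb]_(t in `[(0 : R)%R, +oo[) (g t)%:E = L'%:E - (G 0)%:E)%E.
  apply: ge0_continuous_FTC2y => //.
  - by move=> t /Gd[].
  - exact: halfline_right_cvg.
  - by move=> t; rewrite in_itv/= andbT => t0; apply: der1E; exact: Gd.
have If : (\int[leb]_(t in `[(0 : R)%R, +oo[) (f t + g t)%:E = (L + L')%:E - (F 0 + G 0)%:E)%E.
  apply: (@ge0_continuous_FTC2y _ _ (fun t => F t + G t)) => //.
  - exact: cvgD.
  - by move=> t /FGd[].
  - exact: halfline_right_cvg.
  - by move=> t; rewrite in_itv/= andbT => t0; apply: der1E; exact: FGd.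
have integ (h : R -> R) (r s : R) : {within `[0, +oo[, continuous h} -> (forall t, 0 <= h t) ->
    (\int[leb]_(t in `[(0 : R)%R, +oo[) (h t)%:E = r%:E - s%:E)%E ->
    leb.-integrable `[(0 : R), +oo[ (EFin \o h).
  move=> hc h0 hI; apply/integrableP; split.
    by apply/measurable_EFinP; exact: subspace_continuous_measurable_fun.
  under eq_integral => x _ do rewrite /= ger0_norm//.
  by rewrite hI -EFinB ltry.
have ig := integ _ _ _ gc g0 Ig; have ifg := integ _ _ _ fgc fg0 If.
have fE : f = (fun t => (f t + g t) - g t) by apply/funext => t; rewrite addrK.
split; first by rewrite fE; have := integrableB _ ifg ig; apply.
rewrite fE RintegralB// /Rintegral Ig If -!EFinB/=; ring.
Qed.

End HalfLineIntegral.

(** * Convergence in the critical case *)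

Section CriticalConvergence.
Context {R : realType} (l : R) (l0 : 0 < l).
Implicit Types (t x e : R).
Local Notation Phi := ((pi / l) ^+ 2).
Local Notation leb := (@lebesgue_measure R).

Lemma moment_cvg (phi : R -> R -> R) (w : R -> R) :
  (forall t, 0 <= t -> {within `[0, l], continuous (phi t)}) ->
  {within `[0, l], continuous w} -> metrics_converge l phi w ->
  moment l (phi t) @[t --> +oo] --> moment l w.
Proof.
move=> phic wc /metrics_convergeP H; apply/cvgyP => e e0.
have e20 : 0 < e / 2 / l by rewrite !divr_gt0.
have [M M0 HM] := H _ e20; exists M => // t Mt.
have t0 : 0 <= t by exact: le_trans Mt.
have E : e / 2 / l * l = e / 2 by rewrite divfK// gt_eqF.
have key (u v : R -> R) : {within `[0, l], continuous u} -> {within `[0, l], continuous v} ->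
    (forall x, 0 <= x <= l -> `|u x - v x| < e / 2 / l) ->
    moment l u <= moment l v + e / 2.
  move=> uc vc uv; rewrite -E; apply: moment_le => // x xl.
  have s0 := sin_itv_ge0 l l0 x xl; have s1 := sin_le1 (pi * x / l).
  rewrite -lerBlDl -mulrBl; apply: (@le_trans _ _ (e / 2 / l * sin (pi * x / l))).
    by apply: ler_wpM2r => //; apply: le_trans (ltW (uv x xl)); exact: ler_norm.
  by rewrite ler_piMr// ltW.
have k1 := key _ _ (phic t t0) wc (fun x => HM t x Mt).
have k2 : moment l w <= moment l (phi t) + e / 2.
  by apply: key => // [|x xl]; [exact: phic|rewrite distrC HM].
rewrite ltr_norml; lra.
Qed.

Lemma sine_mode_der (c x : R) : is_derive x 1 (fun x => c * sin (pi * x / l))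
  (c * (cos (pi * x / l) * (pi / l))).
Proof. by apply: der_eq; rewrite /GRing.scale/=; ring. Qed.

Lemma sine_mode_der2 (c x : R) :
  is_derive x 1 (fun x => c * (cos (pi * x / l) * (pi / l)))
  (- Phi * (c * sin (pi * x / l))).
Proof. by apply: der_eq; rewrite /GRing.scale/=; ring. Qed.

Lemma continuous_sine_mode (c : R) (A : set R) :
  {within A, continuous (fun x => c * sin (pi * x / l))}.
Proof.
by apply: continuous_subspaceT => x; exact: der_continuous (sine_mode_der c x).
Qed.

(** The boundary interpolation U and the source f are affine in x at fixed time, so both Fourier
    coefficients of the statement reduce to this formula. *)
Lemma moment_affine (A B : R) :
  moment l (fun s => A * s + B) = l / pi * (A * l + 2 * B).
Proof.
have pi0 := pi_gt0 R.
have Fd (x : R) : is_derive x 1 (fun x => (l / pi) ^+ 2 * A * sin (pi * x / l) -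
    l / pi * ((A * x + B) * cos (pi * x / l))) ((A * x + B) * sin (pi * x / l)).
  apply: der_eq; rewrite /GRing.scale/=.
  by move: (pi : R) pi0 => ppi ppi0; field; rewrite !gt_eqF.
rewrite /moment (Rintegral_der _ _ _ _ l0 _ Fd).
  rewrite mulfK ?gt_eqF// !(mulr0, mul0r) sinpi cospi sin0 cos0; ring.
move=> x; apply: cvgM; last exact: der_continuous (sine_der l x).
by apply: cvgD; [apply: cvgMr; exact: cvg_id|exact: cvg_cst].
Qed.

(** * Critical solutions with integrable boundary data tending to zero *)

Section Solution.
Variables (phi : R -> R -> R) (mu0 mu1 d0 d1 : R -> R).
Hypothesis phiP : parabolic Phi 0 0 l phi (fun _ _ => 0).
Hypothesis mu0c : {within `[0, +oo[, continuous mu0}.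
Hypothesis mu1c : {within `[0, +oo[, continuous mu1}.
Hypothesis d0c : {within `[0, +oo[, continuous d0}.
Hypothesis d1c : {within `[0, +oo[, continuous d1}.
Hypothesis mu0d : forall t, 0 < t -> is_derive t 1 mu0 (d0 t).
Hypothesis mu1d : forall t, 0 < t -> is_derive t 1 mu1 (d1 t).
Hypothesis bd0 : forall t, 0 <= t -> phi t 0 = mu0 t.
Hypothesis bd1 : forall t, 0 <= t -> phi t l = mu1 t.
Hypothesis lim0 : mu0 t @[t --> +oo] --> (0 : R).
Hypothesis lim1 : mu1 t @[t --> +oo] --> (0 : R).
Hypothesis int0 : (\int[leb]_(t in `[(0 : R)%R, +oo[) (`|mu0 t| + `|d0 t|)%:E < +oo)%E.
Hypothesis int1 : (\int[leb]_(t in `[(0 : R)%R, +oo[) (`|mu1 t| + `|d1 t|)%:E < +oo)%E.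

Let phic t : 0 <= t -> {within `[0, l], continuous (phi t)}.
Proof. by move=> t0; exact: strip_section_continuous t0 phiP.1. Qed.

(** One majorant for two purposes: it dominates |mu_j'| + (Phi/2) |mu_j| for both j, as
    [critical_bound] asks, and, up to the factor 2/pi, the coefficient f1. *)
Let a t := (1 + Phi) * ((`|mu0 t| + `|d0 t|) + (`|mu1 t| + `|d1 t|)).

Let variation_antiderivative : exists (A : R -> R) (L : R),
  [/\ {within `[0, +oo[, continuous a}, {within `[0, +oo[, continuous A},
      forall t, 0 < t -> is_derive t 1 A (a t) & A t @[t --> +oo] --> L].
Proof.
pose v0 (t : R) : R := `|mu0 t| + `|d0 t|.
have c0 : {within `[0, +oo[, continuous v0}.
  by move=> t; apply: cvgD; apply: cvg_norm; [exact: mu0c|exact: d0c].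
pose v1 (t : R) : R := `|mu1 t| + `|d1 t|.
have c1 : {within `[0, +oo[, continuous v1}.
  by move=> t; apply: cvgD; apply: cvg_norm; [exact: mu1c|exact: d1c].
have [A0 [A0c A0d]] := halfline_antiderivative _ c0.
have [A1 [A1c A1d]] := halfline_antiderivative _ c1.
have [|L0 HL0] := halfline_antiderivative_cvg _ _ c0 A0c A0d _ int0.
  by move=> t; rewrite addr_ge0.
have [|L1 HL1] := halfline_antiderivative_cvg _ _ c1 A1c A1d _ int1.
  by move=> t; rewrite addr_ge0.
exists (fun t => (1 + Phi) * (A0 t + A1 t)), ((1 + Phi) * (L0 + L1)); split.
- by move=> t; apply: cvgMr; apply: cvgD; [exact: c0|exact: c1].
- by move=> t; apply: cvgMr; apply: cvgD; [exact: A0c|exact: A1c].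
- move=> t t0; apply: (der_eq _ (derM (der_cst (1 + Phi) t) (derD (A0d t t0) (A1d t t0)))).
  by rewrite /a /v0 /v1; ring.
- by apply: cvgMr; exact: cvgD.
Qed.

(** At a late time [T] the boundary values and the remaining variation of [A] are small. The profile
    is then within 2 e1 of a finite sine sum, and [critical_bound] carries this closeness to all
    later times while the sine sum tends to its first mode. *)
Let near_sine e : 0 < e -> exists2 T, 0 <= T &
  exists b, forall t x, T <= t -> 0 <= x <= l -> `|phi t x - b * sin (pi * x / l)| <= e.
Proof.
(* The total error is 38 * (2 e1) from the barrier plus e1 from the decay of the higher modes, 77 e1
   in all. *)
move=> e0; pose e1 := e / 100; have e10 : 0 < e1 by rewrite /e1; lra.
have l0' := l0; have pi0 := pi_gt0 R.
have Phi0 : 0 < Phi by rewrite exprn_gt0// divr_gt0.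
have [A [L [ac Ac Ad AL]]] := variation_antiderivative.
have [T0 T00 HT0] := (cvgyP _ _).1 lim0 e1 e10.
have [T1 T10 HT1] := (cvgyP _ _).1 lim1 e1 e10.
have [T2 T20 HT2] := (cvgyP _ _).1 AL e1 e10.
pose T := Num.max T0 (Num.max T1 T2).
have T0T : T0 <= T by rewrite le_max lexx.
have T1T : T1 <= T by rewrite !le_max lexx orbT.
have T2T : T2 <= T by rewrite !le_max lexx !orbT.
have TT0 : 0 <= T by exact: le_trans T0T.
have [p /= [_ p2 p3]] := sine_approx l l0 (phi T) e1 (phic _ TT0) e10.
have [P [b [C [PP P0 Pb [C0 PC] _]]]] := sine_evolution_poly l l0 p.
have uP : parabolic Phi 0 0 l (fun t x => phi (T + t) x - P t x) (fun _ _ => 0).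
  apply: (parabolic_ext _ _ (parabolicB (parabolic_shift _ _ _ _ _ _
    (parabolicW TT0 (lexx 0) (lexx l) phiP)) PP)) => // t x; by rewrite subr0.
have m0 t : 0 <= t -> `|mu0 (T + t)| < e1.
  by move=> t0; have := HT0 (T + t); rewrite subr0; apply; lra.
have m1 t : 0 <= t -> `|mu1 (T + t)| < e1.
  by move=> t0; have := HT1 (T + t); rewrite subr0; apply; lra.
have bound t x : 0 <= t -> 0 <= x <= l -> `|phi (T + t) x - P t x| <= 38 * (2 * e1).
  apply: (critical_bound l l0 _ (fun t => mu0 (T + t)) (fun t => mu1 (T + t))
    (fun t => d0 (T + t)) (fun t => d1 (T + t)) (fun t => a (T + t))
    (fun t => A (T + t)) _ uP).
  - exact: halfline_shift.
  - exact: halfline_shift.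
  - exact: halfline_der_shift.
  - exact: halfline_der_shift.
  - move=> s s0; have [-> ->] := Pb s; rewrite !subr0 bd0 ?bd1//; exact: addr_ge0.
  - exact: halfline_shift.
  - exact: halfline_shift.
  - exact: halfline_der_shift.
  - move=> s s0; rewrite /a.
    have := normr_ge0 (mu0 (T + s)); have := normr_ge0 (d0 (T + s)).
    have := normr_ge0 (mu1 (T + s)); have := normr_ge0 (d1 (T + s)).
    set m0' := `|mu0 _|; set m1' := `|mu1 _|; set d0' := `|d0 _|; set d1' := `|d1 _|.
    move: Phi Phi0 => q q0 h1 h2 h3 h4; split; nra.
  - move=> s s0; rewrite addr0.
    have := HT2 (T + s) ltac:(lra); have := HT2 T T2T; rewrite !ltr_norml; lra.
  - move=> y yl; rewrite addr0 P0.
    have := m0 0 (lexx 0); have := m1 0 (lexx 0); rewrite !addr0 !ltr_norml => h1 h0.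
    have ph0 := bd0 T TT0; have phl := bd1 T TT0.
    have := p2 e1 y (ltW e10) ltac:(lra) ltac:(lra) yl.
    have := p3 e1 y (ltW e10) ltac:(lra) ltac:(lra) yl.
    rewrite ler_norml; lra.
have [M M0 HM] := expR_decay Phi C e1 Phi0 C0 e10.
exists (T + M); first exact: addr_ge0.
exists b => t x tTM xl.
have tT : 0 <= t - T by lra.
have -> : phi t x - b * sin (pi * x / l) =
    (phi (T + (t - T)) x - P (t - T) x) + (P (t - T) x - b * sin (pi * x / l)).
  have -> : T + (t - T) = t by ring.
  ring.
apply: le_trans (ler_normD _ _) _.
have := bound _ x tT xl; have := PC _ x tT; have := HM (t - T) ltac:(lra).
rewrite /e1; lra.
Qed.

(** The amplitude in [near_sine] depends on e. It is read off at the midpoint, where the sine is 1: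
    the values phi(t, l/2) are Cauchy, and their limit is the common amplitude. *)
Lemma critical_cvg : exists c, metrics_converge l phi (fun x => c * sin (pi * x / l)).
Proof.
have l0' := l0; have pi0 := pi_gt0 R.
have mid : 0 <= l / 2 <= l by lra.
have sm : sin (pi * (l / 2) / l) = 1.
  have -> : pi * (l / 2) / l = pi / 2.
    by move: (pi : R) pi0 => ppi ppi0; field; rewrite !gt_eqF.
  exact: sin_pihalf.
have : cvg (phi t (l / 2) @[t --> +oo]).
  apply: cauchy_cvg; apply: cauchy_exP => e e0.
  have [T T0 [b Hb]] := near_sine (e / 2) ltac:(lra).
  exists b; exists T; split; first exact: num_real.
  move=> t Tt; have := Hb t (l / 2) (ltW Tt) mid.
  by rewrite sm mulr1 /ball /= distrC; lra.
move=> /cvg_ex[c /cvgyP Hc]; exists c; apply/metrics_convergeP => e e0.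
have [T T0 [b Hb]] := near_sine (e / 4) ltac:(lra).
have [M M0 HM] := Hc (e / 4) ltac:(lra).
exists (Num.max T M); first by rewrite le_max T0.
move=> t x; rewrite ge_max => /andP[Tt Mt] xl.
have h1 := Hb t x Tt xl; have h2 := Hb t (l / 2) Tt mid; have h3 := HM t Mt.
rewrite sm mulr1 in h2.
have sx0 := sin_itv_ge0 l l0 x xl; have sx1 := sin_le1 (pi * x / l).
have h4 : `|b - c| <= e / 2.
  by move: h2 h3; rewrite ltr_norml !ler_norml; lra.
have h5 : `|(b - c) * sin (pi * x / l)| <= e / 2.
  by rewrite normrM (ger0_norm sx0); apply: le_trans h4; rewrite ler_piMr.
have -> : phi t x - c * sin (pi * x / l) =
  (phi t x - b * sin (pi * x / l)) + (b - c) * sin (pi * x / l) by ring.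
apply: le_lt_trans (ler_normD _ _) _; lra.
Qed.

(** [moment_growth] is applied to phi with boundary bounds m_j + e and to - phi with - m_j + e; the
    two one-sided bounds combine. *)
Let moment_slope (s t m0 m1 e : R) : 0 <= s <= t ->
  (forall r, s <= r <= t -> `|mu0 r - m0| <= e /\ `|mu1 r - m1| <= e) ->
  `|moment l (phi t) - moment l (phi s) - pi / l * (t - s) * (m0 + m1)| <=
    pi / l * (t - s) * (2 * e).
Proof.
move=> /andP[s0 st] H; have h0 : 0 <= t - s by rewrite subr_ge0.
have uP := parabolic_shift _ _ _ _ _ _ (parabolicW s0 (lexx 0) (lexx l) phiP).
have NuP : parabolic Phi 0 0 l (fun r x => (-1) * phi (s + r) x) (fun _ _ => 0).
  by apply: parabolic_ext (parabolicZ (-1) uP) => // ? ?; rewrite mulr0.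
have bd r : 0 <= r <= t - s -> [/\ phi (s + r) 0 = mu0 (s + r), phi (s + r) l = mu1 (s + r),
    `|mu0 (s + r) - m0| <= e & `|mu1 (s + r) - m1| <= e].
  move=> rts; have [|h1 h2] := H (s + r); first lra.
  by split => //; [apply: bd0|apply: bd1]; lra.
have := moment_growth l l0 _ (m0 + e) (m1 + e) (t - s) uP h0.
rewrite addr0 (addrC s (t - s)) subrK => U1.
have := moment_growth l l0 _ (- m0 + e) (- m1 + e) (t - s) NuP h0.
rewrite addr0 (addrC s (t - s)) subrK !momentZ; last 2 first.
- exact: phic.
- by apply: phic; lra.
move=> U2.
have {}U1 : moment l (phi t) <= moment l (phi s) + pi / l * (t - s) * (m0 + e + (m1 + e)).
  by apply: U1 => r /bd[-> ->]; rewrite !ler_norml; lra.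
have {}U2 : -1 * moment l (phi t) <=
    -1 * moment l (phi s) + pi / l * (t - s) * (- m0 + e + (- m1 + e)).
  by apply: U2 => r /bd[-> ->]; rewrite !ler_norml; lra.
rewrite ler_norml; move: U1 U2; set q := pi / l * (t - s) => U1 U2.
apply/andP; split; nra.
Qed.

(** On a short time interval the boundary values are nearly constant, so [moment_slope] pins down
    the difference quotient on either side of t. This replaces the formal integration by parts. *)
Let moment_der t : 0 < t ->
  is_derive t 1 (fun t => moment l (phi t)) (pi / l * (mu0 t + mu1 t)).
Proof.
move=> t0; have l0' := l0; have pi0 := pi_gt0 R; apply: is_derive1_cvg => e e0.
pose e1 := e / (pi / l * 2).
have q0 : 0 < pi / l * 2 by rewrite mulr_gt0// divr_gt0.
have e10 : 0 < e1 by rewrite divr_gt0.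
have c0 := der_continuous (mu0d t t0); have c1 := der_continuous (mu1d t t0).
move/cvgrPdist_le : c0 => /(_ e1 e10) [del0 /= del00 H0].
move/cvgrPdist_le : c1 => /(_ e1 e10) [del1 /= del10 H1].
exists (Num.min t (Num.min del0 del1)); first by rewrite !lt_min t0 del00.
move=> h h0; rewrite !lt_min => /and3P[ht hd0 hd1].
have near_mu r : `|r - t| <= `|h| -> `|mu0 r - mu0 t| <= e1 /\ `|mu1 r - mu1 t| <= e1.
  move=> rt; rewrite (distrC (mu0 r)) (distrC (mu1 r)); split; [apply: H0|apply: H1] => /=;
    by rewrite distrC (le_lt_trans rt).
have key : `|moment l (phi (t + h)) - moment l (phi t) - pi / l * h * (mu0 t + mu1 t)|
    <= pi / l * `|h| * (2 * e1).
  have [hp|hn] := ltP 0 h.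
    have := moment_slope t (t + h) (mu0 t) (mu1 t) e1.
    have -> : t + h - t = h by ring.
    rewrite (gtr0_norm hp); apply; first lra.
    by move=> r rt; apply: near_mu; rewrite (gtr0_norm hp) ger0_norm; lra.
  have hh : `|h| = - h by rewrite ler0_norm.
  have := moment_slope (t + h) t (mu0 t) (mu1 t) e1.
  have -> : t - (t + h) = - h by ring.
  rewrite hh => K.
  have -> : moment l (phi (t + h)) - moment l (phi t) - pi / l * h * (mu0 t + mu1 t) =
    - (moment l (phi t) - moment l (phi (t + h)) - pi / l * - h * (mu0 t + mu1 t)) by ring.
  rewrite normrN; apply: K; first by move: ht; rewrite hh; lra.
  by move=> r rt; apply: near_mu; rewrite hh ler0_norm; lra.
have -> : (moment l (phi (t + h)) - moment l (phi t)) / h - pi / l * (mu0 t + mu1 t) =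
    (moment l (phi (t + h)) - moment l (phi t) - pi / l * h * (mu0 t + mu1 t)) / h.
  by field; rewrite h0 gt_eqF.
rewrite normrM normfV ler_pdivrMr ?normr_gt0//; apply: le_trans key _.
have -> : pi / l * `|h| * (2 * e1) = e1 * (pi / l * 2) * `|h| by ring.
by rewrite /e1 divfK// gt_eqF.
Qed.

Let moment_continuous : {within `[0, +oo[, continuous (fun t : R => moment l (phi t))}.
Proof.
apply/continuous_within_itvcyP; split.
  by move=> t; rewrite in_itv/= andbT => t0; exact: der_continuous (moment_der t t0).
have pil : 0 <= pi / l by rewrite divr_ge0 ?pi_ge0 ?ltW.
have /cvgrPdist_le/(_ 1 ltr01) c0 := halfline_right_cvg _ mu0c.
(* Boundary values within 1 of their values at 0 already give a Lipschitz bound with constant [K] at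
   t = 0, enough for continuity there. *)
have /cvgrPdist_le/(_ 1 ltr01) c1 := halfline_right_cvg _ mu1c.
pose K := pi / l * (`|mu0 0 + mu1 0| + 2).
have K0 : 0 < K + 1 by rewrite ltr_wpDl// mulr_ge0// addr_ge0.
have [del0 /= del00 H0] := c0; have [del1 /= del10 H1] := c1.
apply/cvgrPdist_le => e e0.
exists (Num.min (e / (K + 1)) (Num.min del0 del1)).
  by rewrite /= !lt_min del00 del10 divr_gt0.
move=> t /=; rewrite sub0r normrN !lt_min => /and3P[te td0 td1] t0.
rewrite gtr0_norm// in te td0 td1.
have := moment_slope 0 t (mu0 0) (mu1 0) 1.
rewrite lexx (ltW t0) subr0 => /(_ isT) S.
have {}S : `|moment l (phi t) - moment l (phi 0) - pi / l * t * (mu0 0 + mu1 0)| <=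
     pi / l * t * (2 * 1).
  apply: S => r /andP[r0 rt]; have [->|r0'] := eqVneq r 0; first by rewrite !subrr normr0.
  have rp : 0 < r by rewrite lt_neqAle eq_sym r0'.
  rewrite (distrC (mu0 r)) (distrC (mu1 r)); split; [apply: H0|apply: H1] => //=;
    by rewrite sub0r normrN gtr0_norm// (le_lt_trans rt).
rewrite distrC.
have -> : moment l (phi t) - moment l (phi 0) =
  (moment l (phi t) - moment l (phi 0) - pi / l * t * (mu0 0 + mu1 0)) +
  pi / l * t * (mu0 0 + mu1 0) by ring.
apply: le_trans (ler_normD _ _) _.
apply: (@le_trans _ _ (K * t)).
  rewrite /K; have -> : `|pi / l * t * (mu0 0 + mu1 0)| = pi / l * t * `|mu0 0 + mu1 0|.
    by rewrite normrM ger0_norm// mulr_ge0// ltW.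
  by move: S; set X := `|_ - _|; lra.
move: te; rewrite ltr_pdivlMr// => te.
by have := ltW t0; lra.
Qed.

(* The first Fourier sine coefficient of [phi t - U t] has derivative [f1] and
   converges to the limit amplitude. *)
Lemma critical_integral (phi0 : R -> R) c :
  (forall x, 0 <= x <= l -> phi 0 x = phi0 x) ->
  metrics_converge l phi (fun x => c * sin (pi * x / l)) ->
  v1coef l mu0 mu1 phi0 + (\int[leb]_(t in `[0, +oo[) f1coef l Phi mu0 mu1 t)%R = c.
Proof.
move=> init cv; have l0' := l0; have pi0 := pi_gt0 R.
(* [k] is f1 in closed form, and [F] is the first sine coefficient of phi - U, the moment of U being
   (l/pi) (mu0 + mu1). Hence F' = k, F(0) is the initial coefficient, and F tends to c because U
   tends to 0. *)
pose k t := 2 / pi * (Phi * (mu0 t + mu1 t) - (d0 t + d1 t)).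
pose F t := 2 / l * moment l (phi t) - 2 / pi * (mu0 t + mu1 t).
have Mlim : moment l (phi t) @[t --> +oo] --> c * (l / 2).
  rewrite -(moment_sin1 l l0) -momentZ.
    by apply: moment_cvg => //; exact: continuous_sine_mode.
  by apply: continuous_subspaceT => x; exact: der_continuous (sine_der l x).
have Flim : F t @[t --> +oo] --> c.
  have -> : c = 2 / l * (c * (l / 2)) - 2 / pi * (0 + 0).
    by rewrite addr0 mulr0 subr0; field; rewrite gt_eqF.
  apply: cvgB; apply: cvgMr; first exact: Mlim.
  exact: cvgD lim0 lim1.
have kc : {within `[0, +oo[, continuous k}.
  move=> t; apply: cvgMr; apply: cvgB.
    by apply: cvgMr; apply: cvgD; [exact: mu0c|exact: mu1c].
  by apply: cvgD; [exact: d0c|exact: d1c].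
have Fc : {within `[0, +oo[, continuous F}.
  move=> t; apply: cvgB; apply: cvgMr; first exact: moment_continuous.
  by apply: cvgD; [exact: mu0c|exact: mu1c].
have Fd t : 0 < t -> is_derive t 1 F (k t).
  move=> t0; apply: (der_eq _ (derB (derM (der_cst (2 / l) t) (moment_der t t0))
    (derM (der_cst (2 / pi) t) (derD (mu0d t t0) (mu1d t t0))))).
  by rewrite /k; move: (pi : R) pi0 => ppi ppi0; field; rewrite !gt_eqF.
have [A [L [ac Ac Ad AL]]] := variation_antiderivative.
have g_ge t : `|k t| <= 2 / pi * a t.
  have q0 : 0 <= 2 / pi :> R by apply: divr_ge0; [lra|exact: ltW].
  rewrite /k normrM (ger0_norm q0); apply: ler_wpM2l => //.
  rewrite /a; apply: le_trans (ler_normB _ _) _.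
  rewrite normrM (ger0_norm (sqr_ge0 (pi / l))).
  have h1 := ler_normD (mu0 t) (mu1 t); have h2 := ler_normD (d0 t) (d1 t).
  have := normr_ge0 (mu0 t); have := normr_ge0 (mu1 t).
  have := normr_ge0 (d0 t); have := normr_ge0 (d1 t).
  have := sqr_ge0 (pi / l); move: (Phi) h1 h2 => q; nra.
have gc : {within `[0, +oo[, continuous (fun t : R => 2 / pi * a t)}.
  by move=> t; apply: cvgMr; exact: ac.
have Gc : {within `[0, +oo[, continuous (fun t : R => 2 / pi * A t)}.
  by move=> t; apply: cvgMr; exact: Ac.
have Gd t : 0 < t -> is_derive t 1 (fun t => 2 / pi * A t) (2 / pi * a t).
  by move=> t0; apply: (der_eq _ (derM (der_cst (2 / pi) t) (Ad t t0))); ring.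
have Glim : 2 / pi * A t @[t --> +oo] --> 2 / pi * L by apply: cvgMr.
have [ik Ik] := Rintegral_halfline _ _ _ _ _ _ kc gc Fc Gc Fd Gd g_ge Flim Glim.
have f1E t : 0 < t -> f1coef l Phi mu0 mu1 t = k t.
  move=> t0; rewrite /f1coef.
  have -> : (\int[leb]_(s in `[0, l]) (ffun_source l Phi mu0 mu1 t s * sin (pi * s / l)))%R =
    moment l (fun s => ((Phi * mu1 t - d1 t) - (Phi * mu0 t - d0 t)) / l * s +
      (Phi * mu0 t - d0 t)).
    apply: eq_Rintegral => s _; congr (_ * _); rewrite /ffun_source.
    have Ud : is_derive t 1 (fun r => Ufun l mu0 mu1 r s)
        (d0 t * ((l - s) / l) + d1 t * (s / l)).
      apply: (der_eq _ (derD (derM (mu0d t t0) (der_cst ((l - s) / l) t))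
        (derM (mu1d t t0) (der_cst (s / l) t)))); ring.
    by rewrite (half_deriveE _ _ _ t0 Ud) /Ufun; field; rewrite gt_eqF.
  rewrite moment_affine /k.
  by move: (Phi) (pi : R) pi0 => q ppi ppi0; field; rewrite !gt_eqF.
have -> : (\int[leb]_(t in `[0, +oo[) f1coef l Phi mu0 mu1 t)%R = c - F 0.
  (* The formula for f1 has been established for t > 0, where the half-line derivative is two-sided;
     dropping the endpoint 0 leaves both integrals unchanged. *)
  have ik' : leb.-integrable `](0 : R), +oo[ (EFin \o k).
    apply: integrableS ik => //=.
    by move=> x; rewrite /= !in_itv/= !andbT; exact: ltW.
  have if1 : leb.-integrable `](0 : R), +oo[ (EFin \o (f1coef l Phi mu0 mu1)).
    apply: eq_integrable ik' => //= x; rewrite inE/= in_itv/= andbT => x0.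
    by rewrite f1E.
  rewrite -Ik -Rintegral_itv_obnd_cbnd// -[RHS]Rintegral_itv_obnd_cbnd//.
  by apply: eq_Rintegral => t; rewrite inE/= in_itv/= andbT => /f1E.
suff -> : v1coef l mu0 mu1 phi0 = F 0 by rewrite addrC subrK.
rewrite /v1coef /F.
have Ac' : {within `[0, l], continuous (fun s : R => -1 * ((mu1 0 - mu0 0) / l * s + mu0 0))}.
  apply: continuous_subspaceT => x; apply: cvgMr.
  by apply: cvgD; [apply: cvgMr; exact: cvg_id|exact: cvg_cst].
have -> : (\int[leb]_(s in `[0, l]) (v0fun l mu0 mu1 phi0 s * sin (pi * s / l)))%R =
    moment l (fun s => phi 0 s + -1 * ((mu1 0 - mu0 0) / l * s + mu0 0)).
  apply: eq_Rintegral => s; rewrite inE/= in_itv/= => sl; congr (_ * _).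
  by rewrite /v0fun /Ufun -init//; field; rewrite gt_eqF.
have Bc : {within `[0, l], continuous (fun s : R => (mu1 0 - mu0 0) / l * s + mu0 0)}.
  apply: continuous_subspaceT => x.
  by apply: cvgD; [apply: cvgMr; exact: cvg_id|exact: cvg_cst].
rewrite (momentD _ _ _ (phic 0 (lexx 0)) Ac') (momentZ _ _ _ Bc) moment_affine.
by move: (pi : R) pi0 => ppi ppi0; field; rewrite !gt_eqF.
Qed.

End Solution.

End CriticalConvergence.

(** * Curvature of warped products *)

Section WarpedGeometry.
Context {R : realType} {n : nat} {M : smooth_manifold R n} (h : riemannian_metric M).
Variable c : chart M.
Implicit Types (w : R -> R) (s : R) (p a b v : 'rV[R]_(1 + n)) (y : 'rV[R]_n).
Local Notation N := (@dx_field R n).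
Local Notation i0 := (lshift n (@ord0 0)).

(** Writing the metric as dx^2 + w^2 [fiber_form] confines the dependence on x to a scalar
    factor. *)
Definition fiber_form y : 'M[R]_(1 + n) := block_mx 0 0 0 (h c y).

Lemma dx_fieldE : N = delta_mx 0 i0.
Proof.
apply/rowP => j; rewrite !mxE eqxx /=; case: (split_ordP j) => k -> /=.
  by rewrite !ord1 mxE eqxx.
by rewrite mxE.
Qed.

Lemma mul_dx_tr v : v *m N^T = (v 0 i0)%:M.
Proof.
by rewrite dx_fieldE trmx_delta -colE; apply/rowP => j; rewrite !mxE !ord1 eqxx.
Qed.

Lemma dx_mul_tr : N *m N^T = 1%:M.
Proof. by rewrite mul_dx_tr dx_fieldE mxE !eqxx. Qed.

Lemma dx_fiber_form y : N *m fiber_form y = 0.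
Proof.
by rewrite /dx_field /fiber_form mul_row_block !mulmx0 mul0mx !addr0 row_mx0.
Qed.

Lemma fiber_form_dx y : fiber_form y *m N^T = 0.
Proof.
rewrite /dx_field tr_row_mx /fiber_form mul_block_col trmx0 !mul0mx mulmx0 !addr0.
by rewrite col_mx0.
Qed.

Lemma warpedE w p : warped h w c p =
  N^T *m N + w (lsubmx p 0 0) ^+ 2 *: fiber_form (rsubmx p).
Proof.
rewrite /warped /dx_field /fiber_form tr_row_mx mul_col_row trmx1 trmx0.
rewrite !mul1mx !mul0mx scale_block_mx !scaler0 add_block_mx.
by rewrite !add0r !addr0.
Qed.

Definition slice y (s : R) : 'rV[R]_(1 + n) := s *: N + row_mx 0 y.

Lemma slice_point p : p = slice (rsubmx p) (lsubmx p 0 0).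
Proof.
rewrite /slice /dx_field scale_row_mx scaler0 add_row_mx addr0 add0r.
by rewrite scalemx1 -mx11_scalar hsubmxK.
Qed.

Lemma lsubmx_slice y s : lsubmx (slice y s) 0 0 = s.
Proof.
rewrite /slice /dx_field scale_row_mx scaler0 add_row_mx row_mxKl addr0.
by rewrite !mxE eqxx mulr1.
Qed.

Lemma rsubmx_slice y s : rsubmx (slice y s) = y.
Proof. by rewrite /slice /dx_field scale_row_mx scaler0 add_row_mx row_mxKr add0r. Qed.

Lemma warped_pointE x q : warped_point c x q = slice (chart_map c q) x.
Proof.
rewrite /warped_point [LHS]slice_point row_mxKl row_mxKr.
by rewrite mxE eqxx.
Qed.

(** The two difference quotients are equal term by term, so no differentiability enters. *)
Lemma derive_slice (f : 'rV[R]_(1 + n) -> R) y s :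
  'D_N f (slice y s) = derive1 (fun r => f (slice y r)) s.
Proof.
have E : (fun r : R => r^-1 *: ((f \o shift (slice y s)) (r *: N) - f (slice y s))) =
    (fun r => r^-1 *: (f (slice y (r + s)) - f (slice y s))).
  by apply/funext => r; rewrite /= /slice scalerDl addrA.
by rewrite /derive E /derive1.
Qed.

Lemma fiber_form0l y j : fiber_form y i0 j = 0.
Proof.
have := dx_fiber_form y; rewrite dx_fieldE -rowE => /rowP/(_ j).
by rewrite !mxE.
Qed.

Lemma fiber_form0r y j : fiber_form y j i0 = 0.
Proof.
have := fiber_form_dx y; rewrite dx_fieldE trmx_delta -colE => /colP/(_ j).
by rewrite !mxE.
Qed.

Local Notation g w := (warped h w c).

Lemma warped0l w p j : g w p i0 j = N 0 j.
Proof.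
rewrite warpedE mxE [X in _ + X]mxE fiber_form0l mulr0 addr0.
by rewrite mxE big_ord1 mxE dx_fieldE [X in X * _]mxE !eqxx mul1r.
Qed.

Lemma warped0r w p j : g w p j i0 = N 0 j.
Proof.
rewrite warpedE mxE [X in _ + X]mxE fiber_form0r mulr0 addr0.
by rewrite mxE big_ord1 mxE dx_fieldE [X in _ * X]mxE !eqxx mulr1.
Qed.

(* No nondegeneracy is needed: [invmx] returns a singular matrix unchanged. *)
Lemma invmx_warped0 w p k : invmx (g w p) i0 k = N 0 k.
Proof.
have [gu|gu] := boolP (g w p \in unitmx); last by rewrite /invmx (negbTE gu) warped0l.
have E : N *m g w p = N.
  rewrite warpedE mulmxDr -scalemxAr dx_fiber_form scaler0 addr0.
  by rewrite mulmxA dx_mul_tr mul1mx.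
have : N *m invmx (g w p) = N by rewrite -{1}E mulmxK.
by rewrite {1}dx_fieldE -rowE => /rowP/(_ k); rewrite mxE.
Qed.

Lemma partial_cst (i : 'I_(1 + n)) (f : 'rV[R]_(1 + n) -> R) (k : R) p :
  (forall q, f q = k) -> partial i f p = 0.
Proof.
move=> fk; have -> : f = cst k by apply/funext.
exact: derive_cst.
Qed.

(** Row 0 of the inverse metric is that of the identity and the entries g_0j are constant, so a
    single term survives. Since r pairs the curvature with N, x-components suffice, and derivatives
    of the fibre metric along the fibre never enter. *)
Lemma christoffel0 w i j p :
  christoffel (g w) i0 i j p = - (2^-1 * partial i0 (fun q => g w q i j) p).
Proof.
rewrite /christoffel -mulrN; congr (_ * _).
rewrite (bigD1 i0)//= big1 => [|k ki].
  rewrite invmx_warped0 dx_fieldE mxE !eqxx mul1r addr0.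
  rewrite (@partial_cst i _ (N 0 j)) => [|q]; last exact: warped0r.
  rewrite (@partial_cst j _ (N 0 i)) => [|q]; last exact: warped0r.
  by rewrite !add0r.
by rewrite invmx_warped0 dx_fieldE mxE (negbTE ki) andbF mul0r.
Qed.

Lemma christoffel0l w k j p : christoffel (g w) k i0 j p =
  2^-1 * \sum_(i < 1 + n) invmx (g w p) k i * partial i0 (fun q => g w q j i) p.
Proof.
rewrite /christoffel; congr (_ * _); apply: eq_bigr => i _; congr (_ * _).
rewrite (@partial_cst j _ (N 0 i)) => [|q]; last exact: warped0l.
rewrite (@partial_cst i _ (N 0 j)) => [|q]; last exact: warped0l.
by rewrite subr0 addr0.
Qed.

Lemma partial_dx_warped w (dw : R) y s i j : is_derive s 1 w dw ->
  partial i0 (fun q => g w q i j) (slice y s) = 2 * w s * dw * fiber_form y i j.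
Proof.
move=> wd; rewrite /partial -dx_fieldE derive_slice.
have -> : (fun r => g w (slice y r) i j) =
    (fun r => (N^T *m N) i j + w r ^+ 2 * fiber_form y i j).
  by apply/funext => r; rewrite warpedE lsubmx_slice rsubmx_slice mxE [X in _ + X]mxE.
apply: der1E; apply: (der_eq _ (derD (der_cst ((N^T *m N) i j) s)
  (derM (der_exp 1 wd) (der_cst (fiber_form y i j) s)))); ring.
Qed.

Definition fiber_product y a b : R := (a *m fiber_form y *m b^T) 0 0.

Lemma fiber_productE y a b :
  fiber_product y a b = \sum_i \sum_j fiber_form y i j * a 0 i * b 0 j.
Proof.
rewrite /fiber_product mxE exchange_big /=; apply: eq_bigr => j _.
rewrite mxE big_distrl /=; apply: eq_bigr => i _.
by rewrite [b^T _ _]mxE; ring.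
Qed.

(** Up to sign convention, this is the second fundamental form of the slices x = const. *)
Lemma christoffel_dx_sum w (dw : R) y s a b : is_derive s 1 w dw ->
  \sum_(i < 1 + n) \sum_(j < 1 + n) christoffel (g w) i0 i j (slice y s) * a 0 i * b 0 j =
  - (w s * dw * fiber_product y a b).
Proof.
move=> wd; rewrite fiber_productE !mulr_sumr -sumrN; apply: eq_bigr => i _.
rewrite mulr_sumr -sumrN; apply: eq_bigr => j _.
by rewrite christoffel0 (partial_dx_warped _ _ _ _ _ _ wd); field.
Qed.

Lemma covariant_cst_dx w a b p : covariant (g w) (cst a) (cst b) p 0 i0 =
  \sum_(i < 1 + n) \sum_(j < 1 + n) christoffel (g w) i0 i j p * a 0 i * b 0 j.
Proof.
rewrite /covariant mxE; have -> : (fun q => cst b q 0 i0) = cst (b 0 i0) by [].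
by rewrite derive_cst add0r.
Qed.

Lemma covariant_dx_cst_dx w b p : covariant (g w) (cst N) (cst b) p 0 i0 = 0.
Proof.
rewrite covariant_cst_dx big1// => i _; rewrite big1// => j _.
rewrite dx_fieldE mxE eqxx /=; case: eqP => [->|_]; last by rewrite mulr0 mul0r.
rewrite christoffel0 (@partial_cst i0 _ (N 0 j)) => [|q]; last exact: warped0l.
by rewrite mulr0 oppr0 !mul0r.
Qed.

(** Where w is nonzero this is (w'/w) times the fibre part of b. The inverse metric is left in
    place, to be absorbed later by [fiber_form_inv]. *)
Lemma covariant_dx_cst w (dw : R) y s b : is_derive s 1 w dw ->
  covariant (g w) (cst N) (cst b) (slice y s) =
  (w s * dw) *: (b *m fiber_form y *m (invmx (g w (slice y s)))^T).
Proof.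
move=> wd; apply/rowP => k; rewrite /covariant mxE.
have -> : (fun q => cst b q 0 k) = cst (b 0 k) by [].
rewrite derive_cst add0r (bigD1 i0)//= [X in _ + X]big1 ?addr0; last first.
  move=> i ii0; rewrite big1// => j _.
  by rewrite dx_fieldE mxE eqxx (negbTE ii0) mulr0 mul0r.
have -> : N 0 i0 = 1 by rewrite dx_fieldE mxE !eqxx.
rewrite mxE [in RHS]mxE mulr_sumr.
under eq_bigr => j _ do rewrite mulr1 christoffel0l.
under [RHS]eq_bigr => i _ do rewrite mxE big_distrl mulr_sumr /=.
rewrite exchange_big /=; apply: eq_bigr => j _.
rewrite mulr_sumr big_distrl /=; apply: eq_bigr => i _.
by rewrite (partial_dx_warped _ _ _ _ _ _ wd) [_^T _ _]mxE; field.
Qed.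

Lemma lie_bracket_cst a b : lie_bracket (cst a) (cst b) = cst 0.
Proof.
apply/funext => p; apply/rowP => k; rewrite /lie_bracket !mxE.
by rewrite !(derive_cst (_ : R)) subrr.
Qed.

Lemma covariant0 w b p : covariant (g w) (cst 0) (cst b) p = 0.
Proof.
apply/rowP => k; rewrite /covariant !mxE derive0 add0r big1// => i _.
by rewrite big1// => j _; rewrite mxE mulr0 mul0r.
Qed.

Lemma inner_dx w p v : inner (g w) p v N = v 0 i0.
Proof.
rewrite /inner warpedE -mulmxA mulmxDl -scalemxAl fiber_form_dx scaler0 addr0.
by rewrite -mulmxA dx_mul_tr mulmx1 mul_dx_tr mxE eqxx.
Qed.

Lemma metric_perp_warped w y s a b :
  metric_perp (g w) N (slice y s) a b = w s ^+ 2 * fiber_product y a b.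
Proof.
have perp_dx v : perp (g w) N (slice y s) v *m N^T = 0.
  rewrite /perp inner_dx mulmxBl -scalemxAl dx_mul_tr mul_dx_tr scalemx1.
  by rewrite subrr.
rewrite /metric_perp /inner warpedE lsubmx_slice rsubmx_slice.
rewrite mulmxDr mulmxA perp_dx mul0mx add0r -scalemxAr -scalemxAl mxE.
congr (_ * _); rewrite /fiber_product /perp mulmxBl -scalemxAl dx_fiber_form scaler0 subr0.
rewrite linearB linearZ /= mulmxBr -scalemxAr -[a *m _ *m N^T]mulmxA fiber_form_dx.
by rewrite mulmx0 scaler0 subr0.
Qed.

Section AtPoint.
Variables (q : M) (domq : dom c q).
Local Notation y := (chart_map c q).

Lemma coef_unitmx : h c y \in unitmx.
Proof.
rewrite -row_free_unit -kermx_eq0; apply/eqP/row_matrixP => i.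
rewrite row0; apply/eqP; apply: contraT => v0.
have := coef_pos h domq v0; have -> : row i (kermx (h c y)) *m h c y = 0.
  by apply/sub_kermxP; exact: row_sub.
by rewrite mul0mx mxE ltxx.
Qed.

Lemma fiber_formT : (fiber_form y)^T = fiber_form y.
Proof. by rewrite /fiber_form tr_block_mx !trmx0 (coef_sym h domq). Qed.

Lemma fiber_product_gt0 a : (forall k : R, a <> k *: N) -> 0 < fiber_product y a a.
Proof.
move=> aN; rewrite /fiber_product -[a]hsubmxK /fiber_form mul_row_block !mulmx0 !add0r.
rewrite tr_row_mx mul_row_col mul0mx add0r; apply: (coef_pos h domq).
apply/eqP => ra0; apply: (aN (lsubmx a 0 0)).
rewrite [LHS]slice_point /slice ra0 row_mx0 addr0.
by [].
Qed.

Lemma warped_unitmx w s : w s != 0 -> g w (slice y s) \in unitmx.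
Proof.
move=> ws; rewrite /warped lsubmx_slice rsubmx_slice unitmxE det_lblock det1 mul1r detZ.
have := coef_unitmx; rewrite unitmxE => hu; rewrite unitrM hu andbT.
by rewrite !unitrX// unitfE.
Qed.

(** With [D] the projection onto the fibre directions, w^2 [fiber_form] equals g D, so the inverse
    cancels against g and no block inverse has to be computed. *)
Lemma fiber_form_inv w s : w s != 0 ->
  fiber_form y *m invmx (g w (slice y s)) *m fiber_form y = w s ^- 2 *: fiber_form y.
Proof.
move=> ws; have gu := warped_unitmx w s ws.
pose D : 'M[R]_(1 + n) := block_mx 0 0 0 1%:M.
have ND : N *m D = 0 by rewrite /dx_field /D mul_row_block !mulmx0 mul0mx !addr0 row_mx0.
have BD : fiber_form y *m D = fiber_form y.
  by rewrite /fiber_form /D mulmx_block !mulmx0 !mul0mx mulmx1 !addr0 !add0r.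
have gD : g w (slice y s) *m D = w s ^+ 2 *: fiber_form y.
  rewrite warpedE lsubmx_slice rsubmx_slice mulmxDl -mulmxA ND mulmx0 add0r.
  by rewrite -scalemxAl BD.
have -> : fiber_form y *m invmx (g w (slice y s)) *m fiber_form y =
    w s ^- 2 *: (fiber_form y *m invmx (g w (slice y s)) *m (g w (slice y s) *m D)).
  by rewrite gD -scalemxAr scalerA mulVf ?expf_neq0// scale1r.
by rewrite mulmxA mulmxKV// BD.
Qed.

(** The bracket of constant fields vanishes. With H the fibre product, the x-component of nabla_N
    nabla_a b is (- w w' H)' = - (w'^2 + w w'') H, that of nabla_a nabla_N b is - w'^2 H, and - w
    w'' H remains. An open interval around x is needed because the first-order formula is
    differentiated once more. *)
Lemma partial_ricci_warped w w' (w2 lo hi x : R) a b : lo < x < hi ->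
  (forall z : R, lo < z < hi -> is_derive z 1 w (w' z)) -> is_derive x 1 w' w2 ->
  w x != 0 ->
  partial_ricci (g w) N (slice y x) a b = - (w x * w2 * fiber_product y a b).
Proof.
move=> xlohi wd w'd wx0; have wdx := wd x xlohi.
rewrite /partial_ricci /curvature4 /curvature lie_bracket_cst covariant0 addr0.
rewrite inner_dx mxE [X in _ + X]mxE.
have -> : covariant (g w) (cst N) (covariant (g w) (cst a) (cst b)) (slice y x) 0 i0 =
    - ((w' x ^+ 2 + w x * w2) * fiber_product y a b).
  rewrite {1}/covariant mxE [X in _ + X]big1 ?addr0; last first.
    move=> i _; rewrite big1// => j _.
    rewrite dx_fieldE mxE eqxx /=; case: eqP => [->|_]; last by rewrite mulr0 mul0r.
    rewrite christoffel0 (@partial_cst i0 _ (N 0 j)) => [|p]; last exact: warped0l.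
    by rewrite mulr0 oppr0 !mul0r.
  rewrite derive_slice.
  have fd : is_derive x 1 (fun r => - (w r * w' r * fiber_product y a b))
      (- ((w' x ^+ 2 + w x * w2) * fiber_product y a b)).
    by apply: (der_eq _ (derN (derM (derM wdx w'd) (der_cst (fiber_product y a b) x)))); ring.
  have E : {near x, (fun r => - (w r * w' r * fiber_product y a b)) =1
      (fun r => covariant (g w) (cst a) (cst b) (slice y r) 0 i0)}.
    have : \forall r \near x, r \in `]lo, hi[ by apply: near_in_itvoo; rewrite in_itv.
    apply: filterS => r; rewrite in_itv/= => rlohi.
    by rewrite covariant_cst_dx (christoffel_dx_sum _ _ _ _ _ _ (wd r rlohi)).
  by rewrite derive1E -(near_eq_derive _ E) -?derive1E ?oner_neq0//; exact: der1E.
have -> : covariant (g w) (cst a) (covariant (g w) (cst N) (cst b)) (slice y x) 0 i0 =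
    - (w' x ^+ 2 * fiber_product y a b).
  rewrite {1}/covariant mxE.
  have -> : (fun p => covariant (g w) (cst N) (cst b) p 0 i0) = cst 0.
    by apply/funext => p; exact: covariant_dx_cst_dx.
  rewrite derive_cst add0r (christoffel_dx_sum _ _ _ _ _ _ wdx).
  rewrite (covariant_dx_cst _ _ _ _ _ wdx); congr (- _).
  rewrite {1}/fiber_product linearZ /= -scalemxAr mxE !trmx_mul trmxK fiber_formT.
  rewrite !mulmxA -(mulmxA a) -(mulmxA a) fiber_form_inv// -scalemxAr -scalemxAl mxE.
  by rewrite -/(fiber_product y a b); field.
ring.
Qed.

End AtPoint.

End WarpedGeometry.

(** * Limit metrics *)

Section Flow.
Context {R : realType} {n : nat} {M : smooth_manifold R n} (h : riemannian_metric M).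
Local Notation N := (@dx_field R n).

Lemma inner_warped (c : chart M) (w : R -> R) y (s : R) a b :
  inner (warped h w c) (slice y s) a b =
  (a *m N^T *m (b *m N^T)^T) 0 0 + w s ^+ 2 * fiber_product h c y a b.
Proof.
rewrite /inner warpedE lsubmx_slice rsubmx_slice mulmxDr mulmxDl mxE; congr (_ + _).
  by rewrite trmx_mul trmxK !mulmxA.
by rewrite -scalemxAr -scalemxAl mxE.
Qed.

(** On vectors a, b both sides of the flow equation are 2 phi H(a, b) times the corresponding sides
    of the heat equation. The converse direction divides by phi > 0 and by H(a, a) > 0 for one
    vector a not parallel to N. *)
Lemma normalized_flow_heat (l Phi : R) (phi : R -> R -> R) : (0 < n)%N ->
  classical_regularity l phi -> (forall t x, 0 <= t -> 0 < x < l -> 0 < phi t x) ->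
  normalized_partial_ricci_flow h l Phi phi <-> heat_equation l Phi phi.
Proof.
move=> n0 [_ reg] pos.
have E t x c q a b : 0 < t -> 0 < x < l -> dom c q ->
    let p := warped_point c x q in let H := fiber_product h c (chart_map c q) a b in
    derive1 (fun s => inner (warped h (phi s) c) p a b) t =
      2 * phi t x * derive1 (phi^~ x) t * H /\
    - 2 * partial_ricci (warped h (phi t) c) N p a b +
      2 * Phi * metric_perp (warped h (phi t) c) N p a b =
      2 * phi t x * (derive1n 2 (phi t) x + Phi * phi t x) * H.
  move=> t0 xl cq p H; rewrite /p warped_pointE.
  have [[dt _ _] _] := reg t x t0 xl.
  split.
    under eq_fun do rewrite inner_warped.
    have td : is_derive t 1 (phi^~ x) (derive1 (phi^~ x) t).
      by rewrite derive1E; exact: DeriveDef.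
    apply: der1E; apply: (der_eq _ (derD (der_cst _ t) (derM (der_exp 1 td) (der_cst _ t)))).
    by rewrite /H; ring.
  have zd (z : R) : 0 < z < l -> is_derive z 1 (phi t) (derive1 (phi t) z).
    move=> zl; have [[_ dz _] _] := reg t z t0 zl.
    by rewrite derive1E; exact: DeriveDef.
  have z2d : is_derive x 1 (derive1 (phi t)) (derive1n 2 (phi t) x).
    have [[_ _ dz] _] := reg t x t0 xl.
    by rewrite derive1nS derive1n1 derive1E; exact: DeriveDef.
  have phi0 : phi t x != 0 by rewrite gt_eqF// pos// ltW.
  rewrite metric_perp_warped (partial_ricci_warped h c q cq _ _ _ 0 l x a b xl zd z2d phi0).
  by rewrite -/H; ring.
split=> [flow t x t0 xl|heat t x c q a b t0 xl cq p].
  have [q _] := manifold_nonempty M; have [c cq] := dom_cover q.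
  (* A positive fibre dimension makes this vector differ from every multiple of N. *)
  pose a : 'rV[R]_(1 + n) := row_mx 0 (const_mx 1).
  have aN (k : R) : a <> k *: N.
    move=> /(congr1 rsubmx); rewrite /a /dx_field scale_row_mx !row_mxKr scaler0.
    by move=> /rowP/(_ (Ordinal n0)); rewrite !mxE => /eqP; rewrite oner_eq0.
  have H0 := fiber_product_gt0 h c q cq a aN.
  have [E1 E2] := E t x c q a a t0 xl cq.
  have := flow t x c q a a t0 xl cq; rewrite /= E1 E2.
  move=> /(mulIf (lt0r_neq0 H0)); apply: mulfI.
  by rewrite gt_eqF// mulr_gt0// pos// ltW.
by have [-> ->] := E t x c q a b t0 xl cq; rewrite heat.
Qed.

(** Inserting w'' = - Phi w into r = - w w'' H gives Phi w^2 H. The Gram determinant of a and N is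
    also w^2 H, so the sectional curvature is Phi. *)
Lemma limit_geometry (l Phi : R) (w w' : R -> R) :
  (forall x : R, is_derive x 1 w (w' x)) ->
  (forall x : R, is_derive x 1 w' (- Phi * w x)) ->
  partial_ricci_proportional h l Phi w /\ constant_mixed_curvature h l Phi w.
Proof.
move=> wd w'd.
have E c q x a b : w x != 0 -> dom c q ->
    partial_ricci (warped h w c) N (warped_point c x q) a b =
    Phi * (w x ^+ 2 * fiber_product h c (chart_map c q) a b).
  move=> wx cq; have x1 : x - 1 < x < x + 1 by apply/andP; split; lra.
  rewrite warped_pointE (partial_ricci_warped h c q cq _ _ _ _ _ x a b x1
    (fun z _ => wd z) (w'd x) wx).
  by ring.
split=> [x c q a b _ wx cq p|x c q a _ wx cq aN].
  by rewrite E// /p warped_pointE metric_perp_warped.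
have H0 := fiber_product_gt0 h c q cq a aN.
have N0 : N 0 (lshift n ord0) = 1 by rewrite dx_fieldE mxE !eqxx.
rewrite /sectional -/(partial_ricci _ _ _ a a) E// warped_pointE !inner_dx N0.
rewrite inner_warped mul_dx_tr tr_scalar_mx -scalar_mxM mxE eqxx mulr1n mulr1 addrAC -expr2.
by rewrite subrr add0r mulfK// mulf_neq0 ?expf_neq0// gt_eqF.
Qed.

End Flow.

Lemma sinh_gt0 {R : realType} (x : R) : 0 < x -> 0 < sinh x.
Proof.
by move=> x0; rewrite /sinh divr_gt0// subr_gt0 ltr_expR; lra.
Qed.

(** Reduces the three formulas to one boundary value problem, w'' = - Phi w with end values m0 and
    m1. For Phi > 0 the bound Phi < (pi/l)^2 puts sqrt(Phi) l below pi and keeps the denominator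
    positive. *)
Lemma phi_tilde_spec {R : realType} (l Phi m0 m1 : R) : 0 < l -> Phi < (pi / l) ^+ 2 ->
  exists w' : R -> R,
  [/\ forall x : R, is_derive x 1 (phi_tilde l Phi m0 m1) (w' x),
      forall x : R, is_derive x 1 w' (- Phi * phi_tilde l Phi m0 m1 x),
      phi_tilde l Phi m0 m1 0 = m0 & phi_tilde l Phi m0 m1 l = m1].
Proof.
move=> l0 Phil; have pi0 := pi_gt0 R.
have [Phi0|Phi0|Phi0] := ltgtP 0 Phi.
- pose om := Num.sqrt Phi; have om0 : 0 < om by rewrite sqrtr_gt0.
  have om2 : om ^+ 2 = Phi by rewrite sqr_sqrtr// ltW.
  have oml : om < pi / l.
    by rewrite -(@ltr_pXn2r _ 2%N)// ?om2// nnegrE ltW// divr_gt0.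
  have s0 : 0 < sin (om * l).
    by apply: sin_gt0_pi; rewrite mulr_gt0//= -ltr_pdivlMr.
  have -> : phi_tilde l Phi m0 m1 = fun x =>
      (m1 * sin (om * x) + m0 * sin (om * (l - x))) / sin (om * l).
    by apply/funext => x; rewrite /phi_tilde Phi0.
  exists (fun x => om * (m1 * cos (om * x) - m0 * cos (om * (l - x))) / sin (om * l)).
  split.
  + by move=> x; apply: der_eq; rewrite /GRing.scale/=; ring.
  + by move=> x; rewrite -om2; apply: der_eq; rewrite /GRing.scale/=; ring.
  + by rewrite mulr0 sin0 mulr0 add0r subr0 mulfK// gt_eqF.
  + by rewrite subrr mulr0 sin0 mulr0 addr0 mulfK// gt_eqF.
- pose om := Num.sqrt (- Phi); have om0 : 0 < om by rewrite sqrtr_gt0 oppr_gt0.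
  have om2 : - om ^+ 2 = Phi by rewrite sqr_sqrtr ?opprK// oppr_ge0 ltW.
  pose S := sinh (om * l); have S0 : S != 0 by rewrite gt_eqF// sinh_gt0// mulr_gt0.
  have -> : phi_tilde l Phi m0 m1 = fun x =>
      (m1 * sinh (om * x) + m0 * sinh (om * (l - x))) / S.
    by apply/funext => x; rewrite /phi_tilde ltNge (ltW Phi0) /= lt_eqF.
  exists (fun x => om * (m1 * ((expR (om * x) + expR (- (om * x))) / 2) -
    m0 * ((expR (om * (l - x)) + expR (- (om * (l - x)))) / 2)) / S).
  have sinh0 : sinh (0 : R) = 0 by rewrite /sinh oppr0 subrr mul0r.
  split.
  + by clearbody S => x; rewrite /sinh; apply: der_eq; rewrite /GRing.scale/=; field.
  + by clearbody S => x; rewrite -om2 /sinh; apply: der_eq; rewrite /GRing.scale/=; field.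
  + by rewrite mulr0 sinh0 mulr0 add0r subr0 mulfK.
  + by rewrite subrr mulr0 sinh0 mulr0 addr0 mulfK.
- have -> : phi_tilde l Phi m0 m1 = fun x => m0 + (m1 - m0) * (x / l).
    by apply/funext => x; rewrite /phi_tilde -Phi0 ltxx eqxx.
  exists (fun=> (m1 - m0) / l); split.
  + by move=> x; apply: der_eq; rewrite /GRing.scale/=; ring.
  + by move=> x; rewrite -Phi0 oppr0 mul0r; exact: der_cst.
  + by rewrite mul0r mulr0 addr0.
  + by rewrite divff ?gt_eqF//; ring.
Qed.

Theorem theorem6 (R : realType) (n : nat) (hn : (0 < n)%N)
    (M : smooth_manifold R n) (gbar : riemannian_metric M)
    (l Phi : R) (hl : 0 < l)
    (phi : R -> R -> R) (phi0 mu0 mu1 : R -> R) (mt0 mt1 : R)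
    (hmu0 : forall t, 0 <= t -> 0 <= mu0 t)
    (hmu1 : forall t, 0 <= t -> 0 <= mu1 t)
    (hC0 : C1_half_line mu0) (hC1 : C1_half_line mu1)
    (hlim0 : mu0 t @[t --> +oo] --> mt0)
    (hlim1 : mu1 t @[t --> +oo] --> mt1)
    (hdlim0 : half_derive mu0 t @[t --> +oo] --> (0 : R))
    (hdlim1 : half_derive mu1 t @[t --> +oo] --> (0 : R))
    (hreg : classical_regularity l phi)
    (hpos : forall t x, 0 <= t -> 0 < x < l -> 0 < phi t x)
    (hinit : forall x, 0 <= x <= l -> phi 0 x = phi0 x)
    (hbd0 : forall t, 0 <= t -> phi t 0 = mu0 t)
    (hbd1 : forall t, 0 <= t -> phi t l = mu1 t) :
  (normalized_partial_ricci_flow gbar l Phi phi <-> heat_equation l Phi phi) /\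
  (normalized_partial_ricci_flow gbar l Phi phi ->
   [/\ (pi / l) ^+ 2 < Phi -> metrics_diverge l phi,
       Phi < (pi / l) ^+ 2 ->
         let w := phi_tilde l Phi mt0 mt1 in
         [/\ metrics_converge l phi w,
             partial_ricci_proportional gbar l Phi w &
             constant_mixed_curvature gbar l Phi w] &
       Phi = (pi / l) ^+ 2 ->
         let delta0 := fun t => mu0 t - mt0 in
         let delta1 := fun t => mu1 t - mt1 in
         mt0 = 0 -> mt1 = 0 ->
         integrable_with_derivative delta0 ->
         integrable_with_derivative delta1 ->
         let w := phi_infty l Phi delta0 delta1 phi0 in
         [/\ metrics_converge l phi w,
             partial_ricci_proportional gbar l Phi w &
             constant_mixed_curvature gbar l Phi w]]).
Proof.
have zl : 0 <= (0 : R) <= l by rewrite lexx ltW.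
have ll : 0 <= l <= l by rewrite lexx ltW.
have equiv := normalized_flow_heat gbar l Phi phi hn hreg hpos.
split=> [//|/equiv heat]; have phiP := classical_parabolic l Phi phi hreg heat.
have near_bd (x m : R) (mu : R -> R) : (forall t, 0 <= t -> phi t x = mu t) ->
    mu t @[t --> +oo] --> m -> phi t x @[t --> +oo] --> m.
  move=> E /cvgyP H; apply/cvgyP => e /H[T T0 HT]; exists T => // t Tt.
  by rewrite E ?HT// (le_trans T0).
split=> [Phil|Phil w|Phil delta0 delta1 m00 m10 int0 int1 w].
- exact: supercritical_divergence phiP hpos Phil.
- have [w' [wd w'd w0 wl]] := phi_tilde_spec l Phi mt0 mt1 hl Phil.
  have [geo1 geo2] := limit_geometry gbar l Phi _ _ wd w'd.
  split => //; apply: (subcritical_convergence l Phi phi _ _ hl phiP Phil wd w'd).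
    by rewrite w0; exact: near_bd hbd0 hlim0.
  by rewrite wl; exact: near_bd hbd1 hlim1.
- have dE0 : delta0 = mu0 by apply/funext => t; rewrite /delta0 m00 subr0.
  have dE1 : delta1 = mu1 by apply/funext => t; rewrite /delta1 m10 subr0.
  rewrite m00 in hlim0; rewrite m10 in hlim1; rewrite Phil in phiP.
  rewrite dE0 in int0; rewrite dE1 in int1; rewrite /w Phil dE0 dE1.
  have mu0c := halfline_section _ _ _ _ _ phiP.1 zl hbd0.
  have mu1c := halfline_section _ _ _ _ _ phiP.1 ll hbd1.
  have d0 t := half_derive_is_derive mu0 t hC0.
  have d1 t := half_derive_is_derive mu1 t hC1.
  have [c Hc] := critical_cvg l hl phi mu0 mu1 _ _ phiP mu0c mu1c hC0.2 hC1.2 d0 d1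
    hbd0 hbd1 hlim0 hlim1 int0 int1.
  have cE := critical_integral l hl phi mu0 mu1 _ _ phiP mu0c mu1c hC0.2 hC1.2 d0 d1
    hbd0 hbd1 hlim0 hlim1 int0 int1 phi0 c hinit Hc.
  (* The amplitude obtained from compactness-free convergence is unspecified; [critical_integral]
     equates it with the Fourier expression, after which the limit is a solution of w'' = - Phi
     w. *)
  have -> : phi_infty l ((pi / l) ^+ 2) mu0 mu1 phi0 = fun x => c * sin (pi * x / l).
    by apply/funext => x; rewrite /phi_infty cE.
  have [geo1 geo2] := limit_geometry gbar l ((pi / l) ^+ 2) _ _
    (sine_mode_der l c) (sine_mode_der2 l c).
  by split.
Qed.
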